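(* Let $E$ and $F$ be Banach spaces. If the pair $(E,F)$ has the James property, then there exists an operator in $\mathcal{L}(E,F)$ which does not attain its norm.
   Context: All Banach spaces are over a fixed field $\mathbb{K}$, which is either $\mathbb{R}$ or $\mathbb{C}$. $\mathcal{L}(E,F)$ is the space of all bounded linear operators from $E$ into $F$ with the operator norm, and $B_E$ is the closed unit ball of $E$. The weak operator topology (WOT) on $\mathcal{L}(E,F)$ is the topology in which a net $(T_\alpha)$ converges to $T$ if and only if $y^*(T_\alpha(x)) \to y^*(T(x))$ for all $x\in E$ and $y^*\in F^*$. James property: a pair $(E,F)$ of Banach spaces has the James property if there exists a relatively WOT-compact set $K\subseteq \mathcal{L}(E,F)$ (i.e. the WOT-closure of $K$ in $\mathcal{L}(E,F)$ is WOT-compact) such that $0\in\overline{K}^{WOT}$ and $0\notin \overline{\operatorname{co}}^{\|\cdot\|}(K)$, where $\overline{\operatorname{co}}^{\|\cdot\|}(K)$ is the norm-closed convex hull of $K$. An operator $T\in\mathcal{L}(E,F)$ attains its norm if there exists $x\in B_E$ with $\|T(x)\|=\|T\|$. *)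

(* Defs.v *)
From HB Require Import structures.
From mathcomp Require Export all_boot all_order all_algebra.
From mathcomp Require Export complex.
From mathcomp Require Export all_classical all_reals all_analysis.
Export numFieldNormedType.Exports.

Set Implicit Arguments.
Unset Strict Implicit.
Unset Printing Implicit Defensive.

Import Order.TTheory GRing.Theory Num.Theory.

Local Open Scope classical_set_scope.
Local Open Scope ring_scope.

(* The definitions are stated over any K : numFieldType, of which both a
   realType R and its complexification R[i] are instances. In R[i] the order
   is x <= y iff y - x is a nonnegative real, so 0 < e says that e is a positive
   real, and norms are nonnegative reals seen in R[i]. *)
Section bounded_operators.
Context {K : numFieldType} {E F : normedModType K}.

Definition bounded_linear : {pred E -> F} :=
  [pred f | `[< linear f /\ exists M : K, forall x, `|f x| <= M * `|x| >]].

Lemma bounded_linearP f : reflect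
  (linear f /\ exists M : K, forall x, `|f x| <= M * `|x|)
  (f \in bounded_linear).
Proof. exact: asboolP. Qed.

Lemma bounded_linear_submod_closed : submod_closed bounded_linear.
Proof.
split.
  apply/bounded_linearP; split.
    by move=> a x y /=; rewrite scaler0 addr0.
  by exists 0 => x; rewrite normr0 mul0r.
move=> a f g /bounded_linearP[lf [M fM]] /bounded_linearP[lg [N gN]].
apply/bounded_linearP; split.
  move=> b x y; rewrite !fctE /= lf lg !scalerDr !scalerA (mulrC a b).
  by rewrite addrACA.
exists (`|a| * M + N) => x; rewrite !fctE.
rewrite (le_trans (ler_normD _ _))// normrZ mulrDl -mulrA lerD//.
by rewrite ler_wpM2l.
Qed.

HB.instance Definition _ :=
  GRing.isSubmodClosed.Build K (E -> F) bounded_linear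
    bounded_linear_submod_closed.

End bounded_operators.

Record bop (K : numFieldType) (E F : normedModType K) := Bop {
  bop_fun :> E -> F ;
  _ : bop_fun \in bounded_linear }.

Notation "''L' ( E , F )" := (bop E F)
  (at level 8, format "''L' ( E ,  F )") : type_scope.

Section bop_lmodule.
Context {K : numFieldType} {E F : normedModType K}.

HB.instance Definition _ := [isSub for @bop_fun K E F].
HB.instance Definition _ := [Choice of 'L(E, F) by <:].
HB.instance Definition _ := [SubChoice_isSubLmodule of 'L(E, F) by <:].

HB.instance Definition _ (T : 'L(E, F)) :=
  GRing.isLinear.Build K E F *:%R (T : E -> F)
    (proj1 (bounded_linearP _ (valP T))).

End bop_lmodule.

Section operator_norm.
Context {K : numFieldType} {E F : normedModType K}.
Implicit Types (T : 'L(E, F)) (A : set 'L(E, F)).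

(* [supremum] is the least upper bound for the order of K. For K = R[i] the
   set below consists of nonnegative reals and all its upper bounds are real,
   so this is the usual real supremum. *)
Definition opnorm T : K :=
  supremum 0 [set `|T x| | x in [set x : E | `|x| <= 1]].

Definition attains_norm T :=
  exists x : E, `|x| <= 1 /\ `|T x| = opnorm T.

Definition opnorm_closure A : set 'L(E, F) :=
  [set T | forall e : K, 0 < e -> A `&` ball_ opnorm T e !=set0].

End operator_norm.

(* In R[i] the coefficients of [convex_set] lie between 0 and 1 for the order
   above, so they are real. *)
Definition convex_hull (K : numDomainType) (M : lmodType K) (A : set M) :
    set M :=
  smallest (@convex_set K M) A.

Definition dual (K : numFieldType) (F : normedModType K) := 'L(F, K^o).

Definition wot (K : numFieldType) (E F : normedModType K) : topologicalType :=
  sup_topology (fun xy : E * dual F => Topological.on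
    (initial_topology (fun T : 'L(E, F) => xy.2 (T xy.1)))).

Lemma wot_cvgP (K : numFieldType) (E F : normedModType K)
    (G : set_system (wot E F)) (T : wot E F) : Filter G ->
  G --> T <->
  forall (x : E) (y : dual F),
    y ((S : 'L(E, F)) x) @[S --> G] --> y ((T : 'L(E, F)) x).
Proof.
move=> FG; split=> [/cvg_sup GT x y|GT].
  apply: cvg_trans
    (@initial_continuous _ _ (fun S : 'L(E, F) => y (S x)) T).
  exact/cvg_app/(GT (x, y)).
apply/cvg_sup => -[x y] U [_ [[V oV <-] VT]] VU.
apply: filterS VU _; apply: (GT x y).
exact: open_nbhs_nbhs.
Qed.

Definition James_property (K : numFieldType) (E F : normedModType K) :=
  exists A : set 'L(E, F),
    [/\ compact (closure (A : set (wot E F))),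
        closure (A : set (wot E F)) (0 : 'L(E, F)) &
        ~ opnorm_closure (convex_hull A) 0].

(* Main.v *)
(* Suppose every operator from E to F attains its norm. Composing with rank-one
   maps, every functional on E attains its norm, so E is reflexive by James'
   theorem. Let K witness the James property. A countable closing-off argument
   produces a sequence (T_n) in K, a closed separable subspace E_0 of E that
   norms all convex combinations of the T_n and on which T_n tends to 0 in the
   weak operator topology, and a countable set C of functionals such that E_0
   and C norm each other. By reflexivity E is the direct sum of E_0 and the
   annihilator of C, so there is a norm-one projection P onto E_0, and T_n P
   tends to 0 in the weak operator topology of the whole space. Norm attainment
   turns E x F^* into a boundary for L(E, F); James' sup-limsup argument then
   yields convex combinations of the T_n P of small norm, hence by restriction
   to E_0 convex combinations of the T_n of small norm, a contradiction.

   The same abstract form of James' argument, [james_sequence], gives both the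
   reflexivity of E (clusters are ultrafilter limits) and the final
   contradiction (the cluster is 0). Complex spaces are handled as real spaces
   carrying the operator "multiplication by i"; complex operators are the real
   operators intertwining it. *)
From HB Require Import structures.
From mathcomp Require Import ring lra.
Require Import Defs.

Set Implicit Arguments.
Unset Strict Implicit.
Unset Printing Implicit Defensive.

Import Order.TTheory GRing.Theory Num.Theory.

Local Open Scope classical_set_scope.
Local Open Scope ring_scope.

(** * James' argument for convex block sequences *)

Section convex_hull.
Context {R : numDomainType} {V : lmodType R}.
Implicit Types (A : set V) (x y : V).

Lemma sub_convex_hull A : A `<=` convex_hull A.
Proof. exact: sub_smallest. Qed.

Lemma convex_hull_conv A x y (t : R) : 0 <= t <= 1 ->
  convex_hull A x -> convex_hull A y -> convex_hull A (t *: x + (1 - t) *: y).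
Proof.
move=> /andP[t0 t1] Ax Ay B [cB AB].
have := cB x y (Itv01 t0 t1); rewrite !inE => /(_ (Ax B _) (Ay B _)).
exact.
Qed.

Lemma convex_hull_ind A (P : V -> Prop) : (forall x, A x -> P x) ->
  (forall x y (t : R), 0 <= t <= 1 -> P x -> P y -> P (t *: x + (1 - t) *: y)) ->
  forall x, convex_hull A x -> P x.
Proof.
move=> AP cP x; apply: (@smallest_sub _ _ _ P) => //.
by move=> y z t /[!inE] Py Pz; apply: cP => //; rewrite ge0 le1.
Qed.

Lemma convex_hull_sub A B : A `<=` convex_hull B ->
  convex_hull A `<=` convex_hull B.
Proof.
by move=> AB; apply: convex_hull_ind => // *; exact: convex_hull_conv.
Qed.

End convex_hull.

Section convex_blocks.
Context {R : realType} {V : lmodType R}.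
Implicit Types f g h : nat -> V.

Definition tail f n : set V := [set f m | m in [set m | (n <= m)%N]].

(** Since [g n] uses only terms of [f] from [n] on, limits along [f] pass to [g] and the relation is
    transitive. *)
Definition convex_block f g := forall n, convex_hull (tail f n) (g n).

Lemma tail_leq f m n : (m <= n)%N -> tail f n `<=` tail f m.
Proof. by move=> mn _ [k nk <-]; exists k => //; exact: leq_trans nk. Qed.

Lemma convex_hull_tail_leq f m n : (m <= n)%N ->
  convex_hull (tail f n) `<=` convex_hull (tail f m).
Proof.
move=> mn; apply: convex_hull_sub.
by apply: subset_trans (@sub_convex_hull _ _ _); exact: tail_leq.
Qed.

Lemma convex_block_refl f : convex_block f f.
Proof. by move=> n; apply: sub_convex_hull; exists n => /=. Qed.

Lemma convex_block_hull f g n : convex_block f g ->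
  convex_hull (tail g n) `<=` convex_hull (tail f n).
Proof.
move=> fg; apply: convex_hull_sub => _ [m /= nm <-].
exact: convex_hull_tail_leq nm _ (fg m).
Qed.

Lemma convex_block_trans g f h :
  convex_block f g -> convex_block g h -> convex_block f h.
Proof. by move=> fg gh n; apply: convex_block_hull fg _ (gh n). Qed.

Lemma convex_block_subseq f (s : nat -> nat) :
  (forall n, (n <= s n)%N) -> convex_block f (f \o s).
Proof. by move=> sn n; apply: sub_convex_hull; exists (s n) => //; exact: sn. Qed.

End convex_blocks.

Section lower_limit.
Context {R : realType}.
Implicit Types (u v : nat -> R) (c M : R).

(** This is the limit inferior as long as [u] is bounded; hence the bound [M] carried by the lemmas
    below. *)
Definition lower_limit u : R :=
  sup [set c | exists k, forall j, (k <= j)%N -> c <= u j].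

Lemma lower_limit_has_sup u M : (forall n, `|u n| <= M) ->
  has_sup [set c | exists k, forall j, (k <= j)%N -> c <= u j].
Proof.
move=> uM; split.
  by exists (- M), 0%N => j _; have := uM j; rewrite ler_norml => /andP[].
exists M => c [k /(_ k (leqnn k)) cu]; apply: le_trans cu _.
by have := uM k; rewrite ler_norml => /andP[].
Qed.

Lemma le_lower_limit u c M : (forall n, `|u n| <= M) ->
  (exists k, forall j, (k <= j)%N -> c <= u j) -> c <= lower_limit u.
Proof. by move=> uM; exact: (sup_upper_bound (lower_limit_has_sup uM)). Qed.

Lemma lower_limit_le u c M : (forall n, `|u n| <= M) ->
  (forall d, (exists k, forall j, (k <= j)%N -> d <= u j) -> d <= c) ->
  lower_limit u <= c.
Proof. by move=> /lower_limit_has_sup[ne _] uc; exact: ge_sup. Qed.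

Lemma lower_limit_lt u c M : (forall n, `|u n| <= M) ->
  lower_limit u < c -> forall k, exists2 j, (k <= j)%N & u j <= c.
Proof.
move=> uM uc k; apply: contrapT => nuc; move: uc; apply/negP; rewrite -leNgt.
apply: (le_lower_limit uM); exists k => j kj; rewrite leNgt; apply/negP => /ltW ju.
by apply: nuc; exists j.
Qed.

End lower_limit.

(** * The sup-limsup construction of James in abstract form *)

Section James.
Context {R : realType} {V : lmodType R} {B : Type} (ev : B -> V -> R).
Hypothesis ev_scalar : forall b, scalar (ev b).

Let evL b a x y : ev b (a *: x + y) = a * ev b x + ev b y.
Proof. exact: ev_scalar. Qed.

Let evZ b a x : ev b (a *: x) = a * ev b x.
Proof.
have ev0 : ev b 0 = 0 by have := evL b (-1) 0 0; rewrite scaler0 addr0; lra.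
by have := evL b a x 0; rewrite ev0 !addr0.
Qed.

Let evD b x y : ev b (x + y) = ev b x + ev b y.
Proof. by have := evL b 1 x y; rewrite scale1r mul1r. Qed.

Let ge_convex_hull b c A : (forall v, A v -> c <= ev b v) ->
  forall v, convex_hull A v -> c <= ev b v.
Proof.
move=> Ac; apply: convex_hull_ind => // x y t /andP[t0 t1] cx cy.
rewrite evD !evZ; nra.
Qed.

Let le_convex_hull b c A : (forall v, A v -> ev b v <= c) ->
  forall v, convex_hull A v -> ev b v <= c.
Proof.
move=> Ac; apply: convex_hull_ind => // x y t /andP[t0 t1] cx cy.
rewrite evD !evZ; nra.
Qed.

(** In other words, [w b] lies between the limits inferior and superior of [ev b (g j)]. Limits
    along [\oo] and along any ultrafilter finer than [\oo] have this property. *)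
Definition between_limits (g : nat -> V) (w : B -> R) := forall b c,
  ((exists k, forall j, (k <= j)%N -> c <= ev b (g j)) -> c <= w b) /\
  ((exists k, forall j, (k <= j)%N -> ev b (g j) <= c) -> w b <= c).

Variables (f : nat -> V) (M theta : R).
Hypothesis M0 : 0 < M.
Hypothesis theta0 : 0 < theta.
Hypothesis fM : forall n b, `|ev b (f n)| <= M.

Let Psi g b := lower_limit (fun n => ev b (g n)).

Let hull_le v b : convex_hull (tail f 0) v -> `|ev b v| <= M.
Proof.
move=> fv; rewrite ler_norml; apply/andP; split.
  by apply: ge_convex_hull fv => _ [n _ <-]; have := fM n b; rewrite ler_norml => /andP[].
by apply: le_convex_hull fv => _ [n _ <-]; have := fM n b; rewrite ler_norml => /andP[].
Qed.

Let block_le g b n : convex_block f g -> `|ev b (g n)| <= M.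
Proof. by move=> fg; apply: hull_le; apply: convex_hull_tail_leq (fg n). Qed.

(** Eventual lower bounds survive convex combinations of tails, so passing to blocks can only raise
    the limit inferior. *)
Let Psi_le g h N : convex_block f g -> convex_block f h ->
  (forall n, (N <= n)%N -> convex_hull (tail g n) (h n)) ->
  forall b, Psi g b <= Psi h b.
Proof.
move=> fg fh gh b; apply: lower_limit_le (fun n => block_le b n fg) _ => c [k kc].
apply: le_lower_limit (fun n => block_le b n fh) _.
exists (maxn N k) => j; rewrite geq_max => /andP[Nj kj].
by apply: ge_convex_hull (gh _ Nj) => _ [m /= jm <-]; apply: kc; exact: leq_trans jm.
Qed.

Let Psi_le_between g w b : convex_block f g -> between_limits g w -> Psi g b <= w b.
Proof.
move=> fg gw; apply: lower_limit_le (fun n => block_le b n fg) _ => c.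
by have [+ _] := gw b c.
Qed.

(** The sum [s] has used up the weight 1 - q^n of a convex combination, and any hull element with
    weight q^n completes it. *)
Let valid q n s h := convex_block f h /\
  forall g, convex_hull (tail f 0) g -> convex_hull (tail f 0) (s + q ^+ n *: g).

Let dominated (v : V) h (c : R) := forall b, ev b v - Psi h b <= c.

(* [c] is the infimum of [sup_b (ev b v - Psi h'' b)] over all admissible [v] and
   blocks [h''] of [h]; taking for [h'] a subsequence that stays low at a nearly
   optimal point [b] ensures that almost the same value is attained for every choice of the
   limit that is subtracted. *)
Let james_step q n s h (eps : R) :
    (forall g, convex_block f g -> exists2 w, between_limits g w &
      forall v, convex_hull (tail f 0) v -> exists b, theta <= ev b v - w b) ->
  0 < eps -> valid q n s h ->
  exists g h' b c, [/\ convex_hull (tail h n) g, convex_block h h',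
    dominated (s + q ^+ n *: g) h' (c + eps) /\
    (forall k, ev b (h' k) <= ev b (s + q ^+ n *: g) - c + eps),
    (forall g' h'' c', convex_hull (tail h n) g' -> convex_block h h'' ->
      dominated (s + q ^+ n *: g') h'' c' -> c <= c') & theta <= c].
Proof.
move=> nearby eps0 [fh sq].
pose E := [set c : R | exists g h', [/\ convex_hull (tail h n) g, convex_block h h' &
  dominated (s + q ^+ n *: g) h' c]].
(* A limit [w] of [h'] is separated by [theta] from the completed combination at some [b], and
   [Psi h' b <= w b]. *)
have tE c : E c -> theta <= c.
  move=> [g [h' [hg hh' gc]]].
  have fh' := convex_block_trans fh hh'.
  have [w h'w /(_ (s + q ^+ n *: g))[|b bt]] := nearby _ fh'.
    by apply: sq; apply: convex_block_hull fh _ _; exact: convex_hull_tail_leq hg.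
  have := gc b; have := Psi_le_between b fh' h'w; lra.
have E0 : E !=set0.
  exists (M + M), (h n), h; split; [exact: convex_block_refl|exact: convex_block_refl|].
  move=> b.
  have /(hull_le b) : convex_hull (tail f 0) (s + q ^+ n *: h n).
    by apply: sq; apply: convex_hull_tail_leq (fh n).
  rewrite ler_norml => /andP[_].
  have : - M <= Psi h b.
    apply: le_lower_limit (fun n => block_le b n fh) _; exists 0%N => j _.
    by have := block_le b j fh; rewrite ler_norml => /andP[].
  lra.
have infE : has_inf E by split => //; exists theta => c /tE.
have [c [g [h0 [hg hh0 gc]]] cE] := inf_adherent eps0 infE.
have fh0 := convex_block_trans fh hh0.
have [b bc] : exists b, inf E - eps < ev b (s + q ^+ n *: g) - Psi h0 b.
  apply: contrapT => /forallNP nb.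
  suff : inf E <= inf E - eps by lra.
  apply: (ge_inf (proj2 infE)).
  exists g, h0; split => // b; rewrite leNgt; exact/negP.
(* The lower limit of [h0] at [b] is below [l], so infinitely many terms are at most [l] there. They
   form the new block; a subsequence only raises [Psi], so domination is preserved. *)
pose l := ev b (s + q ^+ n *: g) - inf E + eps.
have /(lower_limit_lt (fun n => block_le b n fh0)) : Psi h0 b < l by rewrite /l; lra.
move=> jP; have [j nj jl] := all_sig2 (fun k => cid2 (jP k)).
exists g, (h0 \o j), b, (inf E).
have h0j := @convex_block_subseq _ _ h0 _ nj.
split => //.
- exact: convex_block_trans h0j.
- split => // b'.
  have := gc b'; have : Psi h0 b' <= Psi (h0 \o j) b'.
    by apply: (@Psi_le _ _ 0%N) => //; exact: convex_block_trans h0j.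
  lra.
- move=> g' h'' c' hg' hh'' gc'; apply: (ge_inf (proj2 infE)).
  by exists g', h''.
- by apply: lb_le_inf.
Qed.

(* [phi] stands for the sum of the series [q ^ i (1 - q) g_i]. *)
Lemma james_sequence :
  ~ (forall g, convex_block f g -> exists w, [/\ between_limits g w,
      (forall v, convex_hull (tail f 0) v -> exists b, theta <= ev b v - w b) &
      forall q : R, 0 < q < 1 -> exists phi b0,
        (forall n b, `|phi b - ev b (\sum_(i < n) (q ^+ i * (1 - q)) *: g i)|
                     <= M * q ^+ n) /\
        (forall b, phi b - w b <= phi b0 - w b0)]).
Proof.
move=> H.
have nearby g : convex_block f g -> exists2 w, between_limits g w &
    forall v, convex_hull (tail f 0) v -> exists b, theta <= ev b v - w b.
  by move=> /H[w [gw wt _]]; exists w.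
(* With this ratio the error [2 * M * q] in the final estimate costs at most [theta / 4]. *)
have [q [q0 q1 qM]] : exists q : R, [/\ 0 < q, q < 1 & 8 * M * q <= theta].
  exists (Num.min 2^-1 (theta / (8 * M))); split.
  - by rewrite lt_min invr_gt0 ltr0n divr_gt0// mulr_gt0.
  - by rewrite gt_min invf_lt1 ?ltr0n// ltr1n.
  - rewrite -ler_pdivlMl ?mulr_gt0// [_^-1 * _]mulrC.
    by rewrite ge_min lexx orbT.
have q01 : 0 < q < 1 by rewrite q0 q1.
(* Chosen so that the errors telescope in [sPsi]. *)
pose eps n := q ^+ n.+1 * (theta / 2) * q ^+ n.
have qn0 n : 0 < q ^+ n by exact: exprn_gt0.
have eps0 n : 0 < eps n by rewrite /eps !mulr_gt0// invr_gt0.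
have tpos := theta0; have Mpos := M0.
have [b1 _] : exists b : B, True.
  have fb := @convex_block_refl _ _ f.
  by have [w _ /(_ (f 0%N) (fb 0%N))[b _]] := nearby f fb; exists b.
(* The specification is an implication, so that [choice] gives a total function; invalid states
   receive a dummy value built from [b1]. *)
pose step_spec (x : nat * V * (nat -> V)) (y : V * (nat -> V) * B * R) :=
  let: (n, s, h) := x in let: (g, h', b, c) := y in
  valid q n s h -> [/\ convex_hull (tail h n) g, convex_block h h',
    dominated (s + q ^+ n *: g) h' (c + eps n) /\
    (forall k, ev b (h' k) <= ev b (s + q ^+ n *: g) - c + eps n),
    (forall g' h'' c', convex_hull (tail h n) g' -> convex_block h h'' ->
      dominated (s + q ^+ n *: g') h'' c' -> c <= c') & theta <= c].
have /choice[F FP] x : exists y, step_spec x y.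
  case: x => -[n s] h.
  have [v|nv] := pselect (valid q n s h); last by exists (0, f, b1, 0).
  have [g [h' [b [c Pgc]]]] := james_step nearby (eps0 n) v.
  by exists (g, h', b, c).
pose G x := (F x).1.1.1; pose H' x := (F x).1.1.2.
(* The state is the partial sum together with the current block; the weights used before stage [n]
   add up to 1 - q^n. *)
pose st := fix st n : V * (nat -> V) := if n is m.+1 then
  let x := (m, (st m).1, (st m).2) in
  ((st m).1 + (q ^+ m * (1 - q)) *: G x, H' x) else (0, f).
pose s n := (st n).1; pose h n := (st n).2.
pose g n := G (n, s n, h n).
pose b n := (F (n, s n, h n)).1.2; pose c n := (F (n, s n, h n)).2.
have sS n : s n.+1 = s n + (q ^+ n * (1 - q)) *: g n by [].
have stepP n : valid q n (s n) (h n) ->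
   [/\ convex_hull (tail (h n) n) (g n), convex_block (h n) (h n.+1),
    dominated (s n + q ^+ n *: g n) (h n.+1) (c n + eps n) /\
    (forall k, ev (b n) (h n.+1 k) <= ev (b n) (s n + q ^+ n *: g n) - c n + eps n),
    (forall g' h'' c', convex_hull (tail (h n) n) g' -> convex_block (h n) h'' ->
      dominated (s n + q ^+ n *: g') h'' c' -> c n <= c') & theta <= c n].
  have := FP (n, s n, h n).
  rewrite /step_spec /b /c /g /G -[h n.+1]/(H' (n, s n, h n)) /H'.
  by case: (F _) => [[[? ?] ?] ?].
have sgE n v : s n.+1 + q ^+ n.+1 *: v = s n + q ^+ n *: ((1 - q) *: g n + q *: v).
  by rewrite sS scalerDr !scalerA exprSr addrA.
have hull_step A n v : convex_hull A (g n) -> convex_hull A v ->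
    convex_hull A ((1 - q) *: g n + q *: v).
  move=> Ag Av; rewrite addrC -[1 - q]/(1 - q); apply: convex_hull_conv => //.
  by rewrite !ltW.
have vP n : valid q n (s n) (h n).
  elim: n => [|n IH].
    by split; [exact: convex_block_refl|move=> v; rewrite /s/= add0r expr0 scale1r].
  have [hg hh _ _ _] := stepP n IH; have [fh fs] := IH.
  split; first exact: convex_block_trans hh.
  move=> v fv; rewrite sgE; apply: fs; apply: hull_step => //.
  by apply: convex_block_hull fh _ _; exact: convex_hull_tail_leq hg.
have fh n : convex_block f (h n) by case: (vP n).
have hh m n : (m <= n)%N -> convex_block (h m) (h n).
  elim: n => [|n IH]; first by rewrite leqn0 => /eqP ->; exact: convex_block_refl.
  rewrite leq_eqVlt => /predU1P[->|/IH mn]; first exact: convex_block_refl.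
  by apply: convex_block_trans mn _; have [] := stepP n (vP n).
have hg m n : (m <= n)%N -> convex_hull (tail (h m) n) (g n).
  move=> mn; have [hg _ _ _ _] := stepP n (vP n).
  exact: convex_block_hull (hh _ _ mn) _ hg.
have fg : convex_block f g by move=> n; exact: (hg 0%N).
have PsihP n x : Psi (h n) x <= Psi g x by apply: (@Psi_le _ _ n) => // m; exact: hg.
(* A completion at stage [n] is also one at stage [m]: the intermediate terms are absorbed into the
   completing element. *)
have sg m n v : (m <= n)%N -> convex_hull (tail (h m) m) v ->
    exists2 v', convex_hull (tail (h m) m) v' & s n + q ^+ n *: v = s m + q ^+ m *: v'.
  elim: n v => [|n IH] v; first by rewrite leqn0 => /eqP ->; exists v.
  rewrite leq_eqVlt ltnS => /predU1P[->|mn] hv; first by exists v.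
  rewrite sgE; apply: IH => //; apply: hull_step => //.
  exact: (convex_hull_tail_leq mn (hg _ _ mn)).
(* The choice made at stage [n] competes at stage [m] too, so the infimum [c m] is at most the value
   it achieves. *)
have cmono m n : (m <= n)%N -> c m <= c n + eps n.
  move=> mn; have [_ _ _ cmin _] := stepP m (vP m).
  have [_ _ [gn _] _ _] := stepP n (vP n).
  have [v' hv' sv'] := sg m n _ mn (convex_hull_tail_leq mn (hg _ _ mn)).
  apply: (cmin v' (h n.+1)) => //; first (by apply: hh; exact: leqW).
  by rewrite -sv'.
have [w [gw _ /(_ q q01)[phi [b0 [phiE phimax]]]]] := H g fg.
pose mu := phi b0 - w b0.
have sE n : s n = \sum_(i < n) (q ^+ i * (1 - q)) *: g i.
  elim: n => [|n IH]; first by rewrite big_ord0.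
  by rewrite big_ord_recr/= -IH.
have phis n x : `|phi x - ev x (s n)| <= M * q ^+ n by rewrite sE.
have gM n x : `|ev x (g n)| <= M by exact: block_le.
have phim n x : `|phi x - ev x (s n + q ^+ n *: g n)| <= 2 * M * q ^+ n.
  rewrite evD evZ opprD addrA; apply: (le_trans (ler_normB _ _)).
  rewrite normrM (gtr0_norm (qn0 n)); have := phis n x; have := gM n x.
  rewrite -(ler_pM2l (qn0 n)); lra.
(* All values of [h n.+1] at [b n] are low, hence so are those of later terms of [g], and so is
   [w (b n)]. Thus [phi - w] almost reaches [c n] at [b n], and [mu] is its maximum. *)
have cmu' m n : (m <= n)%N -> c m <= mu + (2 * M + 2 * theta) * q ^+ n.
  move=> mn; apply: le_trans (cmono _ _ mn) _.
  have [_ _ [_ hb] _ _] := stepP n (vP n).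
  have wb : w (b n) <= ev (b n) (s n + q ^+ n *: g n) - c n + eps n.
    have [_] := gw (b n) (ev (b n) (s n + q ^+ n *: g n) - c n + eps n).
    apply; exists n.+1 => j nj; apply: le_convex_hull (hg _ _ nj) => _ [k _ <-].
    exact: hb.
  have := phim n (b n); rewrite ler_norml => /andP[+ _].
  have := phimax (b n); rewrite -/mu.
  have : eps n <= theta * q ^+ n.
    rewrite /eps ler_pM2r//; have Q1 : q ^+ n.+1 <= 1 by rewrite exprn_ile1 ?ltW.
    have : q ^+ n.+1 * theta <= theta by rewrite ger_pMl.
    lra.
  lra.
have cmu n : c n <= mu.
  apply/ler_addgt0Pr => e e0.
  have Q1 : `|q| < 1 by rewrite gtr0_norm.
  have /cvgr0_norm_lt /(_ e e0) near_e := cvg_geometric (2 * M + 2 * theta) Q1.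
  near \oo => m.
  have nm : (n <= m)%N by near: m; exact: nbhs_infty_ge.
  apply: le_trans (cmu' _ _ nm) _; rewrite lerD2l ltW//.
  by apply: le_lt_trans (ler_norm _) _; near: m.
have sPsi n x : ev x (s n) - (1 - q ^+ n) * Psi g x <=
    mu * (1 - q ^+ n) + q ^+ n * (theta / 2) * (1 - q ^+ n).
  elim: n => [|n IH].
    by have := evZ x 0 0; rewrite scale0r mul0r /s/= expr0 => ->; lra.
  have [_ _ [/(_ x) gn _] _ _] := stepP n (vP n).
  have := PsihP n.+1 x; have := cmu n.
  move: gn IH; rewrite sS !evD !evZ /eps exprS; set Q := q ^+ n; set P := Psi g x.
  set S := ev x (s n); set A := ev x (g n) => h1 h2 h3 h4.
  (* The left-hand side for [n.+1] equals (1 - q) (S + Q A - P) + q (S - (1 - Q) P); [h6] bounds the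
     first part and [h7], the induction hypothesis, the second. *)
  have h5 : S + Q * A - P <= mu + q * Q * (theta / 2) * Q by lra.
  have h6 : (1 - q) * (S + Q * A - P) <= (1 - q) * (mu + q * Q * (theta / 2) * Q).
    by rewrite ler_pM2l ?subr_gt0.
  have h7 : q * (S - (1 - Q) * P) <= q * (mu * (1 - Q) + Q * (theta / 2) * (1 - Q)).
    by rewrite ler_pM2l.
  lra.
have tmu : theta <= mu.
  by have [_ _ _ _ /le_trans] := stepP 0%N (vP 0%N); apply.
(* At [b0] the difference [phi - w] equals [mu], while by [sPsi] the sum [s n] accounts for little
   more than the share 1 - q^n of it. So each [g n] must supply the rest, and every [ev b0 (g n)]
   exceeds the limit inferior by [theta / 4], which is absurd. *)
have : Psi g b0 + theta / 4 <= Psi g b0.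
  apply: le_lower_limit (fun n => gM n b0) _; exists 0%N => n _.
  have PsiM : - M <= Psi g b0.
    apply: le_lower_limit (fun n => gM n b0) _; exists 0%N => j _.
    by have := gM j b0; rewrite ler_norml => /andP[].
  have := sPsi n b0; have := phis n.+1 b0; rewrite ler_norml => /andP[_].
  have := Psi_le_between b0 fg gw.
  have : phi b0 = mu + w b0 by rewrite /mu subrK.
  rewrite sS !evD !evZ exprS; have := qn0 n; set Q := q ^+ n; set P := Psi g b0.
  set S := ev b0 (s n); set A := ev b0 (g n) => Q0 h1 h2 h3 h4.
  have h5 : Q * (theta / 2) * (1 - Q) <= Q * (theta / 2) by nra.
  have h6 : Q * (theta / 2 - 2 * M * q) <= Q * ((1 - q) * (A - P)).
    have : q * Q * (- M) <= q * Q * P by rewrite ler_pM2l ?mulr_gt0.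
    have : theta / 2 * Q <= (mu - theta / 2) * Q by rewrite ler_pM2r//; lra.
    lra.
  move: h6; rewrite ler_pM2l// => h6.
  have h7 : theta / 4 <= (1 - q) * (A - P) by lra.
  have : 0 <= A - P by nra.
  by move=> h8; nra.
lra.
Unshelve. all: by end_near. Qed.

End James.

(** * The Hahn-Banach theorem *)

Section HahnBanach.
Context {R : realType} {V : lmodType R}.
Implicit Types (p q : V -> R) (x y v : V).

Definition sublinear p := (forall x y, p (x + y) <= p x + p y) /\
  (forall (a : R) x, 0 <= a -> p (a *: x) <= a * p x).

Lemma sublinear0 p : sublinear p -> p 0 = 0.
Proof.
move=> [pD pZ]; apply/eqP; rewrite eq_le.
have := pZ 0 0 (lexx _); rewrite scale0r mul0r => ->.
by have := pD 0 0; rewrite addr0 lerDl.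
Qed.

Lemma sublinear_ge_opp p x : sublinear p -> - p (- x) <= p x.
Proof.
by move=> sp; have [pD _] := sp; have := pD x (- x); rewrite subrr sublinear0//; lra.
Qed.

Lemma sublinearZ p (a : R) x : sublinear p -> 0 <= a -> p (a *: x) = a * p x.
Proof.
move=> sp a0; have [_ pZ] := sp; have [->|an0] := eqVneq a 0.
  by rewrite scale0r mul0r sublinear0.
apply/eqP; rewrite eq_le pZ//= -ler_pdivlMl ?lt_def ?an0//.
have := pZ a^-1 (a *: x); rewrite scalerA mulVf// scale1r; apply.
by rewrite invr_ge0.
Qed.

(* The largest sublinear functional below [p] with value [- p v] at [- v]. *)
Definition straighten p v x : R :=
  inf [set p (x + t *: v) - t * p v | t in [set t : R | 0 <= t]].

Lemma straighten_has_inf p v x : sublinear p ->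
  has_inf [set p (x + t *: v) - t * p v | t in [set t : R | 0 <= t]].
Proof.
move=> sp; have [pD _] := sp; split; first by eexists; exists 0 => /=.
exists (- p (- x)) => _ [t /= t0 <-].
have := pD (x + t *: v) (- x).
by rewrite addrAC subrr add0r sublinearZ//; lra.
Qed.

Lemma straighten_le p v x t : sublinear p -> 0 <= t ->
  straighten p v x <= p (x + t *: v) - t * p v.
Proof.
move=> sp t0; apply: (ge_inf (proj2 (straighten_has_inf v x sp))).
by exists t.
Qed.

Lemma straighten_sublinear p v : sublinear p -> sublinear (straighten p v).
Proof.
move=> sp; have [pD pZ] := sp; split=> [x y|a x a0].
  rewrite -lerBlDr; apply: lb_le_inf; first by case: (straighten_has_inf v x sp).
  move=> _ [t /= t0 <-]; rewrite lerBlDl -lerBlDr.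
  apply: lb_le_inf; first by case: (straighten_has_inf v y sp).
  move=> _ [s /= s0 <-].
  have := straighten_le v (x + y) sp (addr_ge0 t0 s0).
  have := pD (x + t *: v) (y + s *: v).
  rewrite addrACA -scalerDl; lra.
have [->|an0] := eqVneq a 0.
  rewrite scale0r mul0r; have := straighten_le v 0 sp (lexx 0).
  by rewrite scale0r addr0 (sublinear0 sp) mul0r subr0.
have a_gt0 : 0 < a by rewrite lt_def an0.
rewrite -ler_pdivrMl//; apply: lb_le_inf.
  by case: (straighten_has_inf v x sp).
move=> _ [t /= t0 <-]; rewrite ler_pdivrMl//.
apply: le_trans (straighten_le v _ sp (mulr_ge0 a0 t0)) _.
by rewrite -scalerA -scalerDr; have := pZ a (x + t *: v) a0; lra.
Qed.

(** Zorn's lemma applied to the sublinear functionals below [p]. The pointwise infimum of a chain is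
    finite because [- p (- x)] bounds it from below, and subadditive because two members of a chain
    can be replaced by the smaller one. *)
Lemma minimal_sublinear p : sublinear p -> exists2 q,
  sublinear q /\ (forall x, q x <= p x) &
  forall q', sublinear q' -> (forall x, q' x <= q x) -> q' = q.
Proof.
move=> sp; pose T := {q | sublinear q /\ forall x, q x <= p x}.
pose below (s t : T) := `[< forall x, sval t x <= sval s x >].
have valK (s t : T) : sval s = sval t -> s = t.
  case: s t => [s Ps] [t Pt] /= st; subst t.
  by congr exist; exact: Prop_irrelevance.
have [||||[q [sq qp]] qmin] := @Zorn T below.
- by move=> t; apply/asboolP.
- by move=> r s t /asboolP rs /asboolP st; apply/asboolP => x; exact: le_trans (st x) (rs x).
- move=> s t /asboolP st /asboolP ts; apply/valK/funext => x.
  by apply/eqP; rewrite eq_le st ts.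
- move=> A Atot.
  have [->|/set0P[q0 Aq0]] := eqVneq A set0.
    by exists (exist _ p (conj sp (fun x => lexx _))).
  pose q x := inf [set sval s x | s in A].
  have infq x : has_inf [set sval s x | s in A].
    split; first by exists (sval q0 x), q0.
    exists (- p (- x)) => _ [[s [/= ss sp']] _ <-] /=.
    by have := sublinear_ge_opp x ss; have := sp' (- x); lra.
  have qle s x : A s -> q x <= sval s x.
    by move=> As; apply: (ge_inf (proj2 (infq x))); exists s.
  have sq : sublinear q /\ forall x, q x <= p x.
    split; last first.
      by move=> x; apply: le_trans (qle q0 x Aq0) _; case: q0 {Aq0 qle} => q0 /= [].
    split=> [x y|a x a0].
      rewrite -lerBlDr; apply: lb_le_inf; first by case: (infq x).
      move=> _ [s As <-]; rewrite lerBlDl -lerBlDr.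
      apply: lb_le_inf; first by case: (infq y).
      move=> _ [t At <-]; rewrite lerBlDl.
      wlog st : x y s t As At / below s t => [W|].
        case: (Atot _ _ As At) => [st|ts]; first exact: W.
        by rewrite [x + y]addrC [leRHS]addrC; exact: W.
      have := qle t (x + y) At; have /(_ x) := asboolW st.
      by have [[tD _] _] := svalP t; have := tD x y; lra.
    have [->|an0] := eqVneq a 0.
      rewrite scale0r mul0r; apply: le_trans (qle _ 0 Aq0) _.
      by have [sq0 _] := svalP q0; rewrite sublinear0.
    rewrite -ler_pdivrMl ?lt_def ?an0//; apply: lb_le_inf; first by case: (infq x).
    move=> _ [s As <-]; rewrite ler_pdivrMl ?lt_def ?an0//.
    apply: le_trans (qle _ _ As) _.
    by have [[_ sZ] _] := svalP s; exact: sZ.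
  by exists (exist _ q sq) => s As; apply/asboolP => x; exact: qle.
exists q => // q' sq' q'q.
have sq'' : sublinear q' /\ forall x, q' x <= p x.
  by split => // x; exact: le_trans (q'q x) (qp x).
by have := qmin (exist _ q' sq'') (asboolT q'q) => -[].
Qed.

(** A minimal sublinear functional coincides with all of its straightenings, which makes it
    additive. Starting below [straighten p v] forces the value at [- v] to be at most [- p v]. *)
Theorem Hahn_Banach p v : sublinear p -> exists L : V -> R,
  [/\ scalar L, (forall x, L x <= p x) & L v = p v].
Proof.
move=> sp; have [L [sL Lp] Lmin] := minimal_sublinear (straighten_sublinear v sp).
have LB x y : L x <= L (x + y) - L y.
  have := straighten_le y x sL ler01; rewrite scale1r mul1r.
  rewrite (Lmin _ (straighten_sublinear y sL))//.
  by move=> z; have := straighten_le y z sL (lexx 0); rewrite scale0r addr0 mul0r subr0.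
have LD x y : L (x + y) = L x + L y.
  by apply/eqP; rewrite eq_le; have := LB x y; have [-> _] := sL; rewrite lerBrDr.
have LN x : L (- x) = - L x by have := LD x (- x); rewrite subrr sublinear0//; lra.
have LZ0 (a : R) x : 0 <= a -> L (a *: x) = a * L x.
  move=> a0; have [_ LZ] := sL; apply/eqP; rewrite eq_le LZ//=.
  have := LZ a (- x) a0; rewrite scalerN !LN; lra.
have LZ (a : R) x : L (a *: x) = a * L x.
  have [/LZ0//|a0] := leP 0 a.
  by rewrite -[a]opprK scaleNr LN LZ0 ?mulNr ?oppr_ge0 ?ltW.
have Lp' x : L x <= p x.
  apply: le_trans (Lp x) _.
  by have := straighten_le v x sp (lexx 0); rewrite scale0r addr0 mul0r subr0.
exists L; split => //; first by move=> a x y; rewrite LD LZ.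
apply/eqP; rewrite eq_le Lp'/=.
have := Lp (- v); have := straighten_le v (- v) sp ler01.
by rewrite scale1r addNr sublinear0// LN; lra.
Qed.

End HahnBanach.

(** * The normed space of bounded operators *)

Section bounded_operators.
Context {R : realType} {E F : normedModType R}.
Implicit Types (S T : 'L(E, F)) (x : E) (a M : R).

Lemma bopD S T x : (S + T) x = S x + T x. Proof. by []. Qed.
Lemma bopN T x : (- T) x = - T x. Proof. by []. Qed.
Lemma bopB S T x : (S - T) x = S x - T x. Proof. by []. Qed.
Lemma bopZ a T x : (a *: T) x = a *: T x. Proof. by []. Qed.
Lemma bop0 x : (0 : 'L(E, F)) x = 0. Proof. by []. Qed.

Lemma bop_ext S T : (forall x, S x = T x) -> S = T.
Proof. by move=> ST; apply/val_inj/funext. Qed.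

Lemma bop_intro (f : E -> F) M : linear f -> (forall x, `|f x| <= M * `|x|) ->
  exists T : 'L(E, F), forall x, T x = f x.
Proof.
move=> lf fM; have fb : f \in bounded_linear.
  by apply/bounded_linearP; split => //; exists M.
by exists (Bop fb).
Qed.

Lemma opnorm_has_sup T :
  has_sup [set `|T x| | x in [set x : E | `|x| <= 1]].
Proof.
split; first by exists `|T 0|, 0 => //=; rewrite normr0.
have [_ [M TM]] := bounded_linearP _ (valP T).
exists `|M| => _ [x /= x1 <-]; apply: le_trans (TM x) _.
apply: le_trans (ler_norm _) _.
by rewrite normrM normr_id ler_piMr.
Qed.

Lemma opnorm_ge0 T : 0 <= opnorm T.
Proof.
apply: le_trans (sup_upper_bound (opnorm_has_sup T) _); last first.
  by exists 0 => /=; [rewrite normr0|reflexivity].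
exact: normr_ge0.
Qed.

Lemma le_opnorm T x : `|T x| <= opnorm T * `|x|.
Proof.
have [->|x0] := eqVneq x 0; first by rewrite linear0 !normr0 mulr0.
have nx0 : 0 < `|x| by rewrite normr_gt0.
rewrite -ler_pdivrMr//.
apply: le_trans (sup_upper_bound (opnorm_has_sup T) _); last first.
  exists (`|x|^-1 *: x); last reflexivity.
  by rewrite /= normrZ normfV normr_id mulVf ?gt_eqF.
by rewrite linearZ/= normrZ normfV normr_id mulrC.
Qed.

Lemma opnorm_le T M : 0 <= M -> (forall x, `|T x| <= M * `|x|) -> opnorm T <= M.
Proof.
move=> M0 TM; apply: ge_sup; first by case: (opnorm_has_sup T).
move=> _ [x /= x1 <-]; apply: le_trans (TM x) _.
by rewrite ler_piMr.
Qed.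

Lemma opnorm_adherent T (e : R) : 0 < e ->
  exists2 x, `|x| <= 1 & opnorm T - e < `|T x|.
Proof.
by move=> e0; have [_ [x x1 <-] ?] := sup_adherent e0 (opnorm_has_sup T); exists x.
Qed.

Lemma opnormD S T : opnorm (S + T) <= opnorm S + opnorm T.
Proof.
apply: opnorm_le => [|x]; first by rewrite addr_ge0 ?opnorm_ge0.
by rewrite bopD mulrDl (le_trans (ler_normD _ _))// lerD ?le_opnorm.
Qed.

Lemma opnormZ a T : opnorm (a *: T) = `|a| * opnorm T.
Proof.
have le b S : opnorm (b *: S) <= `|b| * opnorm S.
  apply: opnorm_le => [|x]; first by rewrite mulr_ge0 ?opnorm_ge0.
  by rewrite bopZ normrZ -mulrA ler_wpM2l ?le_opnorm.
have [->|a0] := eqVneq a 0.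
  apply/eqP; rewrite eq_le le/= normr0 mul0r; exact: opnorm_ge0.
apply/eqP; rewrite eq_le le/=.
have := le a^-1 (a *: T); rewrite scalerA mulVf// scale1r normfV.
by rewrite ler_pdivlMl// normr_gt0.
Qed.

Lemma opnorm0_eq0 T : opnorm T = 0 -> T = 0.
Proof.
move=> T0; apply: bop_ext => x; apply/eqP; rewrite -normr_le0.
by have := le_opnorm T x; rewrite T0 mul0r.
Qed.

HB.instance Definition _ :=
  Lmodule_isNormed.Build R 'L(E, F) opnormD opnormZ opnorm0_eq0.

Lemma le_bop_norm T x : `|T x| <= `|T| * `|x|. Proof. exact: le_opnorm. Qed.

Lemma bop_norm_le T M : 0 <= M -> (forall x, `|T x| <= M * `|x|) -> `|T| <= M.
Proof. exact: opnorm_le. Qed.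

End bounded_operators.

Section functionals.
Context {R : realType} {E : normedModType R}.

(** A one-sided bound suffices because [L] is odd; this is the form that [Hahn_Banach] delivers. *)
Lemma functional_intro (L : E -> R) (M : R) : scalar L -> 0 <= M ->
  (forall x, L x <= M * `|x|) ->
  exists2 f : 'L(E, R^o), `|f| <= M & forall x, f x = L x.
Proof.
move=> sL M0 LM.
have LN x : L (- x) = - L x.
  have L0 : L 0 = 0 by have := sL (-1) 0 0; rewrite scaler0 addr0; lra.
  by have := sL (-1) x 0; rewrite L0 !addr0 scaleN1r mulN1r.
have LM' x : `|L x| <= M * `|x|.
  by rewrite ler_norml LM andbT lerNl -LN -[`|x|]normrN LM.
have [f fE] := @bop_intro R E R^o L M sL LM'.
by exists f => //; apply: bop_norm_le => // x; rewrite fE.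
Qed.

Lemma norm_sublinear : sublinear (fun x : E => `|x|).
Proof.
by split=> [x y|a x a0]; [exact: ler_normD|rewrite normrZ ger0_norm].
Qed.

Lemma norming_functional (x : E) :
  exists2 f : 'L(E, R^o), `|f| <= 1 & f x = `|x|.
Proof.
have [L [sL Lx <-]] := Hahn_Banach x norm_sublinear.
have [|f f1 fE] := functional_intro sL ler01; first by move=> y; rewrite mul1r.
by exists f.
Qed.

(** Apply [Hahn_Banach] to the distance from the subspace [A]: it is at most the norm, it vanishes
    on [A], and it is at least [d] at [x]. *)
Lemma separating_functional (A : set E) (x : E) (d : R) : A !=set0 ->
  (forall a y z, A y -> A z -> A (a *: y + z)) -> 0 < d ->
  (forall y, A y -> d <= `|x - y|) ->
  exists f : 'L(E, R^o), (forall y, A y -> f y = 0) /\ f x != 0.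
Proof.
move=> [y0 Ay0] AD d0 dA.
have A0 : A 0 by have := AD (-1) y0 y0 Ay0 Ay0; rewrite scaleN1r addNr.
have AZ a y : A y -> A (a *: y) by move=> Ay; rewrite -[_ *: _]addr0; exact: AD.
have AD' y z : A y -> A z -> A (y + z) by move=> Ay; rewrite -[y]scale1r; exact: AD.
pose p y := inf [set `|y - z| | z in A].
have infp y : has_inf [set `|y - z| | z in A].
  by split; [exists `|y - 0|, 0|exists 0 => _ [z _ <-]].
have ple y z : A z -> p y <= `|y - z|.
  by move=> Az; apply: (ge_inf (proj2 (infp y))); exists z.
have sp : sublinear p.
  split=> [y z|a y a0].
    rewrite -lerBlDr; apply: lb_le_inf; first by case: (infp y).
    move=> _ [u Au <-]; rewrite lerBlDl -lerBlDr.
    apply: lb_le_inf; first by case: (infp z).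
    move=> _ [v Av <-]; rewrite lerBlDr.
    apply: le_trans (ple _ (u + v) (AD' _ _ Au Av)) _.
    by rewrite opprD addrACA addrC; apply: le_trans (ler_normD _ _) _; rewrite addrC.
  have [->|an0] := eqVneq a 0.
    by rewrite scale0r mul0r; have := ple 0 0 A0; rewrite subrr normr0.
  rewrite -ler_pdivrMl ?lt_def ?an0//; apply: lb_le_inf; first by case: (infp y).
  move=> _ [u Au <-]; rewrite ler_pdivrMl ?lt_def ?an0//.
  by apply: le_trans (ple _ (a *: u) (AZ _ _ Au)) _; rewrite -scalerBr normrZ ger0_norm.
have [L [sL Lp Lx]] := Hahn_Banach x sp.
have [|f _ fE] := functional_intro sL ler01.
  by move=> y; rewrite mul1r; apply: le_trans (Lp y) _; have := ple y 0 A0; rewrite subr0.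
exists f; split=> [y Ay|].
  have le0 z : A z -> f z <= 0.
    move=> Az; rewrite fE; apply: le_trans (Lp z) _.
    by have := ple z z Az; rewrite subrr normr0.
  apply/eqP; rewrite eq_le le0//= -oppr_le0 -linearN le0//.
  by rewrite -scaleN1r; exact: AZ.
rewrite fE Lx gt_eqF//; apply: lt_le_trans d0 _.
by apply: lb_le_inf; [case: (infp x)|move=> _ [z /dA ? <-]].
Qed.

End functionals.

(** * Completeness of operator spaces, geometric series and ultrafilter limits *)

Section completeness.
Context {R : realType} {E : normedModType R} {F : completeNormedModType R}.

(** The limit is formed pointwise. Norm bounds valid along [G] pass to it, which yields both its
    boundedness and convergence in norm. *)
Lemma bop_complete (G : set_system 'L(E, F)) :
  ProperFilter G -> cauchy G -> cvg G.
Proof.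
move=> PG /cauchyP cG.
have Gball e : 0 < e -> exists T0 : 'L(E, F), \forall T \near G, `|T0 - T| <= e.
  move=> e0; have [T0 GT0] := cG e e0; exists T0; apply: filterS GT0 => T.
  by rewrite -ball_normE /= => /ltW.
have cvgG x : cvg ((fun T : 'L(E, F) => T x) @ G).
  apply: cauchy_cvg; apply/cauchyP => e e0.
  have e0' : 0 < e / (`|x| + 1) by rewrite divr_gt0// ltr_wpDl.
  have [T0 GT0] := Gball _ e0'; exists (T0 x); rewrite nbhs_simpl /=.
  apply: filterS GT0 => T TT0; rewrite -ball_normE /= -bopB.
  apply: le_lt_trans (le_bop_norm _ _) _.
  have : `|T0 - T| * `|x| <= e / (`|x| + 1) * `|x| by rewrite ler_wpM2r.
  move=> /le_lt_trans; apply; rewrite mulrAC ltr_pdivrMr ?ltr_wpDl//.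
  by rewrite ltr_pM2l// ltrDl.
pose L x := lim ((fun T : 'L(E, F) => T x) @ G).
have LP x : (fun T : 'L(E, F) => T x) @ G --> L x by exact: cvgG.
have linL : linear L.
  move=> a x y; apply: cvg_lim => //.
  have : (fun T : 'L(E, F) => a *: T x + T y) @ G --> a *: L x + L y.
    by apply: cvgD; [apply: cvgZr; exact: LP|exact: LP].
  by under eq_fun do rewrite -linearP.
have Lball r (T0 : 'L(E, F)) : (\forall T \near G, `|T0 - T| <= r) ->
    forall x, `|L x - T0 x| <= r * `|x|.
  move=> GT0 x; apply/ler_addgt0Pr => e e0.
  have [T [T1 /= T2]] := filter_ex (filterI GT0 (cvgr_dist_lt _ _ (LP x) _ e0)).
  have TT0 : `|T x - T0 x| <= r * `|x|.
    rewrite distrC -bopB; apply: le_trans (le_bop_norm _ _) _.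
    by rewrite ler_wpM2r.
  rewrite -[L x - T0 x](subrKA (T x)).
  have := ler_normD (L x - T x) (T x - T0 x); lra.
have [T0 GT0] := Gball 1 ltr01.
have [T TL] : exists T : 'L(E, F), forall x, T x = L x.
  apply: (@bop_intro _ _ _ _ (1 + `|T0|)) => // x.
  rewrite -[L x](subrK (T0 x)) (le_trans (ler_normD _ _))// mulrDl lerD//.
    exact: Lball.
  exact: le_bop_norm.
apply/cvg_ex; exists T; apply/cvg_ballP => e e0.
have e4 : 0 < e / 4 by rewrite divr_gt0.
have [T1 GT1] := Gball _ e4.
apply: filterS (GT1) => S ST1; rewrite -ball_normE /=.
have : `|T - T1| <= e / 4.
  by apply: bop_norm_le => [|x]; [exact: ltW|rewrite bopB TL; exact: Lball].
rewrite -[T - S](subrKA T1); have := ler_normD (T - T1) (T1 - S); lra.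
Qed.

HB.instance Definition _ := Uniform_isComplete.Build 'L(E, F) bop_complete.

End completeness.

Lemma exprn_lt {R : realType} (C q e : R) : 0 < q < 1 -> 0 < e ->
  exists N, forall n, (N <= n)%N -> C * q ^+ n < e.
Proof.
move=> /andP[q0 q1] e0; have Q1 : `|q| < 1 by rewrite gtr0_norm.
have /cvgr0_norm_lt /(_ e e0)[N _ NC] := cvg_geometric C Q1.
by exists N => n /NC; exact: le_lt_trans (ler_norm _).
Qed.

(** This supplies [phi] for [james_sequence]: the weights from [n] on add up to q^n, which bounds
    the tail by [M * q ^+ n]. *)
Lemma geometric_sum {R : realType} {V : completeNormedModType R} (g : nat -> V)
    (M q : R) : 0 < q < 1 -> (forall n, `|g n| <= M) ->
  exists s, forall n, `|s - \sum_(i < n) (q ^+ i * (1 - q)) *: g i| <= M * q ^+ n.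
Proof.
move=> q01 gM; have /andP[q0 q1] := q01.
have qn0 n : 0 < q ^+ n by exact: exprn_gt0.
have M0 : 0 <= M := le_trans (normr_ge0 _) (gM 0%N).
pose u n := \sum_(i < n) (q ^+ i * (1 - q)) *: g i.
have uB n k : `|u (n + k)%N - u n| <= M * (q ^+ n - q ^+ (n + k)).
  elim: k => [|k IH]; first by rewrite addn0 !subrr normr0 mulr0.
  rewrite addnS /u big_ord_recr/= -/(u _) addrAC.
  apply: le_trans (ler_normD _ _) _; rewrite normrZ gtr0_norm ?mulr_gt0 ?subr_gt0//.
  have : q ^+ (n + k) * (1 - q) * `|g (n + k)%N| <= q ^+ (n + k) * (1 - q) * M.
    by rewrite ler_wpM2l// mulr_ge0// ltW// subr_gt0.
  rewrite exprS; lra.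
have uMq n m : (n <= m)%N -> `|u m - u n| <= M * q ^+ n.
  move=> nm; rewrite -(subnKC nm); apply: le_trans (uB _ _) _.
  by rewrite ler_wpM2l// gerBl ltW.
have ucvg : cvg (u @ \oo).
  apply: cauchy_cvg; apply/cauchyP => e e0.
  have [N NM] := exprn_lt M q01 e0.
  exists (u N), N => // m /= Nm; rewrite -ball_normE /= distrC.
  by apply: le_lt_trans (uMq _ _ Nm) _; exact: NM.
exists (lim (u @ \oo)) => n; apply/ler_addgt0Pr => e e0.
have [N _ Ne] := cvgr_dist_lt _ _ ucvg _ e0.
have nN := leq_maxl n N; have /Ne := leq_maxr n N => /= He.
rewrite -[lim _ - _](subrKA (u (maxn n N))); apply: le_trans (ler_normD _ _) _.
by rewrite addrC lerD ?uMq// ltW.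
Qed.

(** An ultrafilter converges to each of its cluster points: if it did not contain a neighbourhood,
    it would contain the complement. *)
Lemma ultra_compact_cvg {T : topologicalType} (K : set T) (I : Type)
    (U : set_system I) (u : I -> T) : UltraFilter U -> compact K ->
  U (u @^-1` K) -> exists2 p, K p & u @ U --> p.
Proof.
move=> UU cK UK; have [p [Kp clp]] := cK (u @ U) _ UK.
exists p => // A Ap; rewrite nbhs_simpl /=.
have [//|UnA] := in_ultra_setVsetC (u @^-1` A) UU.
by have [y []] := clp (~` A) A UnA Ap.
Qed.

Lemma ultra_bounded_cvg {R : realType} (I : Type) (U : set_system I) (u : I -> R)
    (M : R) : UltraFilter U -> (forall i, `|u i| <= M) ->
  exists2 l : R, `|l| <= M & u @ U --> l.
Proof.
move=> UU uM; have [|l] := ultra_compact_cvg (u := u) UU (@segment_compact R (- M) M).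
  by apply: filterE => i /=; rewrite in_itv/= -ler_norml.
by rewrite /= in_itv/= -ler_norml => lM ul; exists l.
Qed.

Lemma ultra_infty : exists U : set_system nat, UltraFilter U /\ \oo `<=` U.
Proof. exact: ultraFilterLemma. Qed.

(** * Helly's theorem on evaluation functionals *)

Section Helly.
Context {R : realType} {E : normedModType R}.

(** Induction on [xs]: if some [f0] kills [xs] but not [y], subtracting a multiple of the evaluation
    at [y] makes [D] vanish at [f0] and reduces to [xs]; otherwise [y] is redundant. *)
Lemma eval_of_annihilator (xs : seq E) (D : 'L(E, R^o) -> R) : scalar D ->
  (forall f : 'L(E, R^o), (forall x, x \in xs -> f x = 0) -> D f = 0) ->
  exists x, forall f : 'L(E, R^o), D f = f x.
Proof.
elim: xs D => [|y xs IH] D sD D0.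
  by exists 0 => f; rewrite linear0 D0.
have [[f0 [f0xs f0y]]|nf0] := pselect (exists f0 : 'L(E, R^o),
    (forall x, x \in xs -> f0 x = 0) /\ f0 y != 0); last first.
  apply: IH => // f fxs; apply: D0 => x; rewrite inE => /predU1P[->|/fxs//].
  by apply/eqP/negPn/negP => fy; apply: nf0; exists f.
pose a := D f0 / f0 y.
have [|f fxs|x xE] := IH (fun f => D f - a * f y).
- by move=> b f g; rewrite sD bopD bopZ /GRing.scale/=; lra.
- have D00 : D (- (f y / f0 y) *: f0 + f) = 0.
    apply: D0 => x; rewrite inE bopD bopZ /GRing.scale/= => /predU1P[->|xxs].
      by rewrite mulNr divfK// addNr.
    by rewrite (fxs x)// (f0xs x)// mulr0 addr0.
  by move: D00; rewrite sD /a; lra.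
- exists (x + a *: y) => f; rewrite linearD linearZ/= -xE.
  by rewrite /GRing.scale/= subrK.
Qed.

(** If [Phi] were at most [t] times the norm on the annihilator of [xs], its restriction would
    extend to all functionals with the same bound. The difference from [Phi] would be an evaluation,
    contradicting the distance of [Phi] from evaluations. *)
Lemma Helly_annihilator (Phi : 'L(E, R^o) -> R) (xs : seq E) (t : R) :
  scalar Phi -> 0 <= t ->
  (forall x, exists f : 'L(E, R^o), t * `|f| < Phi f - f x) ->
  exists f : 'L(E, R^o), [/\ `|f| <= 1, forall x, x \in xs -> f x = 0 & t < Phi f].
Proof.
move=> sPhi t0 Phit; apply: contrapT => /forallNP nf.
have Phi0 : Phi 0 = 0.
  by have := sPhi (-1) 0 0; rewrite scaler0 addr0; lra.
have PhiZ a f : Phi (a *: f) = a * Phi f.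
  by have := sPhi a f 0; rewrite Phi0 !addr0.
pose W : set 'L(E, R^o) := [set f | forall x, x \in xs -> f x = 0].
have W0 : W 0 by [].
have WD f g : W f -> W g -> W (f + g).
  by move=> Wf Wg x xxs; rewrite bopD Wf// Wg// addr0.
have WZ a f : W f -> W (a *: f) by move=> Wf x xxs; rewrite bopZ Wf// scaler0.
have PhiW f : W f -> Phi f <= t * `|f|.
  move=> Wf; rewrite leNgt; apply/negP => tf.
  have f0 : f != 0.
    by apply/eqP => f0; move: tf; rewrite f0 Phi0 normr0 mulr0 ltxx.
  have nf0 : 0 < `|f| by rewrite normr_gt0.
  apply: (nf (`|f|^-1 *: f)); split; last by rewrite PhiZ mulrC ltr_pdivlMr.
    by rewrite normrZ normfV normr_id mulVf ?gt_eqF.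
  exact: WZ.
(* A linear functional below [p] is bounded by [t] times the norm (take [g = 0]) and agrees with
   [Phi] on [W] (take [g = - f]). *)
pose p f := inf [set t * `|f + g| - Phi g | g in W].
have infp f : has_inf [set t * `|f + g| - Phi g | g in W].
  split; first by exists (t * `|f + 0| - Phi 0), 0.
  exists (- (t * `|f|)) => _ [g Wg <-].
  have : t * `|g| <= t * (`|f + g| + `|f|).
    rewrite ler_wpM2l//; have := ler_normB (f + g) f.
    by rewrite addrAC subrr add0r.
  by have := PhiW g Wg; lra.
have ple f g : W g -> p f <= t * `|f + g| - Phi g.
  by move=> Wg; apply: (ge_inf (proj2 (infp f))); exists g.
have sp : sublinear p.
  split=> [f g|a f a0].
    rewrite -lerBlDr; apply: lb_le_inf; first by case: (infp f).
    move=> _ [u Wu <-]; rewrite lerBlDl -lerBlDr.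
    apply: lb_le_inf; first by case: (infp g).
    move=> _ [v Wv <-]; rewrite lerBlDr.
    apply: le_trans (ple _ (u + v) (WD _ _ Wu Wv)) _.
    have := sPhi 1 u v; rewrite scale1r mul1r => ->.
    have : t * `|f + g + (u + v)| <= t * (`|f + u| + `|g + v|).
      by rewrite ler_wpM2l// addrACA ler_normD.
    lra.
  have [->|an0] := eqVneq a 0.
    have := ple (0 *: f) 0 W0.
    by rewrite scale0r mul0r addr0 normr0 mulr0 Phi0 subr0.
  rewrite -ler_pdivrMl ?lt_def ?an0//; apply: lb_le_inf; first by case: (infp f).
  move=> _ [u Wu <-]; rewrite ler_pdivrMl ?lt_def ?an0//.
  apply: le_trans (ple _ (a *: u) (WZ _ _ Wu)) _.
  by rewrite -scalerDr normrZ ger0_norm// PhiZ; lra.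
have [L [sL Lp _]] := Hahn_Banach 0 sp.
have LZ a f : L (a *: f) = a * L f.
  have L0 : L 0 = 0 by have := sL (-1) 0 0; rewrite scaler0 addr0; lra.
  by have := sL a f 0; rewrite L0 !addr0.
have LPhi f : W f -> L f <= Phi f.
  move=> Wf; apply: le_trans (Lp f) _.
  have := ple f (-1 *: f) (WZ _ _ Wf).
  by rewrite PhiZ scaleN1r subrr normr0; lra.
have [||x xE] := @eval_of_annihilator xs (fun f => Phi f - L f).
- by move=> a f g /=; rewrite sPhi sL; lra.
- move=> f Wf; apply/eqP; rewrite subr_eq0 eq_le LPhi// andbT.
  by have := LPhi _ (WZ (-1) f Wf); rewrite PhiZ LZ; lra.
have [f] := Phit x; rewrite -xE.
by have := Lp f; have := ple f 0 W0; rewrite addr0 Phi0; lra.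
Qed.

End Helly.

(** * Countable closing-off and separable closed subspaces *)

Section countable_closures.

(* The hull is the set of values of all terms over the Skolem functions, and terms
   are countable. *)
Lemma countable_hull (I : countType) (U : Type) (P : I -> seq U -> U -> Prop) :
  inhabited I -> (forall i s, exists u, P i s u) ->
  exists m : nat -> U, forall i s, exists j, P i (map m s) (m j).
Proof.
move=> [i0] Pex.
have /choice[op opP] (x : I * seq U) : exists u, P x.1 x.2 u by exact: Pex.
pose i_ n := odflt i0 (unpickle n).
pose eval := fix eval (t : GenTree.tree nat) : U := match t with
  | GenTree.Leaf n => op (i_ n, [::])
  | GenTree.Node n ts => op (i_ n, map eval ts) end.
pose tree_ j := odflt (GenTree.Leaf 0%N) (unpickle j).
exists (eval \o tree_) => i s.
exists (pickle (GenTree.Node (pickle i) (map tree_ s))).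
rewrite /= /tree_ pickleK /= /i_ pickleK /= -map_comp.
exact: (opP (i, _)).
Qed.

Context {R : realType} {V : normedModType R}.

(** Such a sequence encodes a separable closed subspace, namely the set [adherent v] of limits of
    its terms. *)
Definition rational_closed (v : nat -> V) :=
  forall (r : rat) i j, exists k, v k = ratr r *: v i + v j.

Definition adherent (v : nat -> V) : set V :=
  [set u | forall e : R, 0 < e -> exists i, `|u - v i| < e].

Lemma adherent_id v i : adherent v (v i).
Proof. by move=> e e0; exists i; rewrite subrr normr0. Qed.

Lemma adherent_linear v : rational_closed v ->
  forall a y z, adherent v y -> adherent v z -> adherent v (a *: y + z).
Proof.
move=> vQ a y z vy vz e e0.
have e4 : 0 < e / 4 by rewrite divr_gt0.
have [q qa] : exists q : rat, `|a - ratr q| * (`|y| + 1) < e / 4.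
  have d0 : 0 < e / 4 / (`|y| + 1) by rewrite divr_gt0// ltr_wpDl.
  have [q] := @rat_in_itvoo R a (a + e / 4 / (`|y| + 1)) ltac:(by rewrite ltrDl).
  rewrite in_itv/= => /andP[aq qa]; exists q.
  rewrite -ltr_pdivlMr ?ltr_wpDl// distrC gtr0_norm ?subr_gt0//.
  by rewrite ltrBlDl.
have q1 : 0 < `|ratr q| + 1 :> R by rewrite ltr_wpDl.
have [i iy] := vy (e / 4 / (`|ratr q| + 1)) (divr_gt0 e4 q1).
have [j jz] := vz _ e4.
have [k kE] := vQ q i j; exists k; rewrite kE.
have -> : a *: y + z - (ratr q *: v i + v j) =
    (a - ratr q) *: y + (ratr q *: (y - v i) + (z - v j)).
  by rewrite scalerBl scalerBr addrA subrKA opprD addrACA.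
apply: le_lt_trans (ler_normD _ _) _.
have := ler_normD (ratr q *: (y - v i)) (z - v j).
rewrite (normrZ (ratr q)) (normrZ (a - ratr q)).
have : `|a - ratr q| * `|y| <= `|a - ratr q| * (`|y| + 1).
  by rewrite ler_wpM2l// lerDl.
have : `|ratr q| * `|y - v i| <= e / 4.
  move: iy; rewrite ltr_pdivlMr// => /ltW; apply: le_trans.
  by rewrite mulrC ler_wpM2l// lerDl.
lra.
Qed.

Lemma separating_adherent v u : rational_closed v -> ~ adherent v u ->
  exists f : 'L(V, R^o), (forall i, f (v i) = 0) /\ f u != 0.
Proof.
move=> vQ /existsNP[e /not_implyP[e0 /forallNP ve]].
have vu y : adherent v y -> e <= `|u - y|.
  move=> vy; rewrite leNgt; apply/negP => uy.
  have [i iy] := vy (e - `|u - y|) ltac:(by rewrite subr_gt0).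
  apply: (ve i); rewrite -[u - v i](subrKA y); apply: le_lt_trans (ler_normD _ _) _.
  by rewrite -ltrBrDl.
have vn0 : adherent v !=set0 by exists (v 0%N); exact: adherent_id.
have [f [f0 fu]] := separating_functional vn0 (adherent_linear vQ) e0 vu.
by exists f; split => // i; apply: f0; exact: adherent_id.
Qed.

End countable_closures.

(** * Countable norming systems *)

Lemma bop_comp {R : realType} {E F G : normedModType R} (S : 'L(F, G))
    (T : 'L(E, F)) :
  exists2 C : 'L(E, G), `|C| <= `|S| * `|T| & forall x, C x = S (T x).
Proof.
have le x : `|S (T x)| <= `|S| * `|T| * `|x|.
  apply: le_trans (le_bop_norm _ _) _.
  by rewrite -mulrA ler_wpM2l// le_bop_norm.
have lin : linear (fun x => S (T x)) by move=> a x y; rewrite !linearP.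
have [C CE] := bop_intro lin le.
by exists C => //; apply: bop_norm_le => [|x]; [rewrite mulr_ge0|rewrite CE].
Qed.

Section null_sequence.
Context {R : realType} {E F : normedModType R} (J : 'L(E, E)) (K : set 'L(E, F)).

Hypothesis K_small : forall (s : seq (E * 'L(F, R^o))) (e : R), 0 < e ->
  exists T, K T /\ forall p, p \in s -> `|p.2 (T p.1)| < e.

Hypothesis K_cluster : forall (T : nat -> 'L(E, F)) (U : set_system nat),
  UltraFilter U -> (forall n, K (T n)) -> exists T0 : 'L(E, F),
  forall x (z : 'L(F, R^o)), (fun n => z (T n x) : R) @ U --> (z (T0 x) : R).

(** Quadruples let a single application of [countable_hull] produce vectors, functionals on both
    spaces and operators that refer to one another. *)
Let point : Type := (E * 'L(E, R^o) * 'L(F, R^o) * 'L(E, F))%type.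
Let px (u : point) := u.1.1.1.
Let pc (u : point) := u.1.1.2.
Let py (u : point) := u.1.2.
Let pS (u : point) := u.2.
Let dflt : point := (0, 0, 0, 0).

(* The first component of the index selects a Skolem condition, the other two are
   a rational scalar and a precision; unused components of [u] are arbitrary. *)
Let closing (i : nat * rat * nat) (s : seq point) (u : point) : Prop :=
  let: (t, r, m) := i in
  match t, s with
  | 0%N, [:: a; b] => [/\ px u = ratr r *: px a + px b,
      pc u = ratr r *: pc a + pc b & pS u = ratr r *: pS a + pS b]
  | 1%N, [:: a; b] => [/\ px u = J (px a), forall z, pc u z = pc a (J z),
      `|py u| <= 1 & py u (pS a (px b)) = `|pS a (px b)|]
  | 2%N, [:: a] => [/\ `|px u| <= 1, `|pc a| - m.+1%:R^-1 < `|pc a (px u)|,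
      `|pc u| <= 1 & pc u (px a) = `|px a|]
  | 3%N, [:: a] => `|px u| <= 1 /\ `|pS a| - m.+1%:R^-1 < `|pS a (px u)|
  | 4%N, _ => K (pS u) /\ forall i j, (i < size s)%N -> (j < size s)%N ->
      `|py (nth dflt s i) (pS u (px (nth dflt s j)))| < m.+1%:R^-1
  | _, _ => True
  end.

Let closing_ex i s : exists u, closing i s u.
Proof.
case: i => -[t r] m.
have m0 : 0 < m.+1%:R^-1 :> R by rewrite invr_gt0.
case: t => [|[|[|[|[|t]]]]] /=; try by exists dflt.
- case: s => [|a [|b [|d s]]]; try by exists dflt.
  by exists (ratr r *: px a + px b, ratr r *: pc a + pc b, 0,
    ratr r *: pS a + pS b).
- case: s => [|a [|b [|d s]]]; try by exists dflt.
  have [c _ cE] := bop_comp (pc a) J.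
  have [y y1 yE] := norming_functional (pS a (px b)).
  by exists (J (px a), c, y, 0).
- case: s => [|a [|b s]]; try by exists dflt.
  have [x x1 xE] := opnorm_adherent (pc a) m0.
  have [c c1 cE] := norming_functional (px a).
  by exists (x, c, 0, 0).
- case: s => [|a [|b s]]; try by exists dflt.
  have [x x1 xE] := opnorm_adherent (pS a) m0.
  by exists (x, 0, 0, 0).
- have [T [KT Ts]] :=
    K_small [seq (px (nth dflt s ij.2), py (nth dflt s ij.1)) | ij <-
      [seq (i, j) | i <- iota 0 (size s), j <- iota 0 (size s)]] m0.
  exists (0, 0, 0, T); split => // i j si sj.
  apply: (Ts (px (nth dflt s j), py (nth dflt s i))).
  apply/mapP; exists (i, j) => //.
  by apply/allpairsP; exists (i, j); rewrite /= !mem_iota.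
Qed.

(** The enumerated points satisfy all closing conditions. The operators [T n] are picked in [K] to
    be small against the first [n] vectors and functionals, and the enumerated functionals on [F]
    norm enough vectors to force weak convergence to 0 at each [x j]. *)
Lemma null_sequence : exists (x : nat -> E) (c : nat -> 'L(E, R^o)) (T : nat -> 'L(E, F)),
  [/\ rational_closed x /\ rational_closed c,
      (forall i, exists k, x k = J (x i)) /\
      (forall i, exists k, forall z, c k z = c i (J z)),
      (forall i, exists k, `|c k| <= 1 /\ c k (x i) = `|x i|) /\
      (forall i (e : R), 0 < e -> exists k, `|x k| <= 1 /\ `|c i| - e < `|c i (x k)|),
      (forall n, K (T n)) /\
      (forall j (z : 'L(F, R^o)), (fun n => z (T n (x j)) : R) @ \oo --> (0 : R)) &
      forall v (e : R), convex_hull (tail T 0) v -> 0 < e ->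
        exists k, `|x k| <= 1 /\ `|v| - e < `|v (x k)|].
Proof.
have [m mP] := countable_hull (inhabits (0%N, 0, 0%N)) closing_ex.
have inv_lt (e : R) : 0 < e -> exists n : nat, n.+1%:R^-1 < e.
  move=> e0; exists (Num.truncn e^-1).
  by rewrite invf_plt ?posrE// truncnS_gt.
pose S i := pS (m i); pose x i := px (m i); pose c i := pc (m i); pose y i := py (m i).
have xQ : rational_closed x.
  by move=> r i j; have [k [? _ _]] := mP (0%N, r, 0%N) [:: i; j]; exists k.
have cQ : rational_closed c.
  by move=> r i j; have [k [_ ? _]] := mP (0%N, r, 0%N) [:: i; j]; exists k.
have SQ : rational_closed S.
  by move=> r i j; have [k [_ _ ?]] := mP (0%N, r, 0%N) [:: i; j]; exists k.
(* Closing condition 4 is used on the first [n] points with precision [n]. *)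
have /choice[k_ k_P] n : exists k, K (S k) /\ forall i j, (i < n)%N -> (j < n)%N ->
    `|y i (S k (x j))| < n.+1%:R^-1.
  have [k [KS kS]] := mP (4%N, 0, n) (iota 0 n); exists k; split => // i j ni nj.
  have := kS i j; rewrite size_map size_iota => /(_ ni nj).
  by rewrite !(nth_map 0%N) ?size_iota// !nth_iota.
pose T n := S (k_ n).
have KT n : K (T n) by case: (k_P n).
exists x, c, T; split => //.
- split=> i.
    by have [k [? _ _ _]] := mP (1%N, 0, 0%N) [:: i; i]; exists k.
  by have [k [_ ? _ _]] := mP (1%N, 0, 0%N) [:: i; i]; exists k.
- split=> [i|i e e0].
    by have [k [_ _ ? ?]] := mP (2%N, 0, 0%N) [:: i]; exists k.
  have [n ne] := inv_lt e e0.
  have [k [? ck _ _]] := mP (2%N, 0, n) [:: i]; exists k; split => //.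
  by apply: lt_trans ck; rewrite ltrD2l ltrN2.
(* If convergence fails, an ultrafilter finer than [\oo] lives on the indices where the values stay
   at least [e]. Its weak limit [v] at [x j] is shown to be 0: every [y i] kills it, and it lies in
   the closure of the vectors [S i (x j)]. *)
- split => // j z; apply/cvgr0Pnorm_lt => e e0; apply: contrapT => nz.
  pose B := [set n | e <= `|z (T n (x j))|].
  have PB : ProperFilter (within B \oo).
    split; last exact: within_filter.
    move=> B0.
    have {}B0 : \forall n \near \oo, B n -> False by exact: B0.
    apply: nz; apply: filterS B0 => n; by rewrite ltNge => nB; apply/negP.
  have [U [UU BU]] := ultraFilterLemma PB.
  have ooU : \oo `<=` U by move=> A oA; apply: BU; apply: (@filterS _ \oo _ A) => // n An _.
  have UB : U B by apply: BU; exact: withinT.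
  have [T0 T0P] := K_cluster UU KT.
  pose v := T0 (x j).
  have zlim (w : 'L(F, R^o)) : (fun n => w (T n (x j)) : R) @ \oo --> (0 : R) -> w v = 0.
    move=> w0; apply: (cvg_unique (@norm_hausdorff _ R^o) (T0P (x j) w)).
    by move=> A /w0; exact: ooU.
  have yv i : y i v = 0.
    apply: zlim; apply/cvgr0Pnorm_lt => d d0; have [n nd] := inv_lt d d0.
    exists (maxn n (maxn i j).+1) => // l /=; rewrite !geq_max gtn_max => /and3P[nl il jl].
    have [_ /(_ i j il jl) /lt_trans] := k_P l; apply.
    by apply: le_lt_trans nd; rewrite lef_pV2 ?posrE// ler_nat ltnS.
  have SjQ : rational_closed (fun i => S i (x j)).
    by move=> r i i'; have [k kE] := SQ r i i'; exists k; rewrite kE.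
  have vS : adherent (fun i => S i (x j)) v.
    apply: contrapT => /(separating_adherent SjQ)[f [fS]] /negP; apply; apply/eqP.
    by apply: zlim; under eq_fun do rewrite fS; exact: cvg_cst.
  have v0 : v = 0.
    apply/eqP; rewrite -normr_le0; apply/ler_addgt0Pr => d d0; rewrite add0r.
    have d2 : 0 < d / 2 by rewrite divr_gt0.
    have [i iv] := vS _ d2.
    (* The functional [y k] norms [S i (x j)] and kills [v], so [S i (x j)] is no longer than its
       distance to [v]. *)
    have [k [_ _ k1 kE]] := mP (1%N, 0, 0%N) [:: i; j].
    have : `|S i (x j)| <= `|S i (x j) - v|.
      rewrite -[leLHS]kE -[y k _]subr0 -(yv k) -linearB.
      apply: le_trans (ler_norm _) _; apply: le_trans (le_bop_norm _ _) _.
      by rewrite ler_piMl.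
    have := ler_normD (v - S i (x j)) (S i (x j)).
    by rewrite subrK [`|S i (x j) - v|]distrC; lra.
  have [n [/= + Bn]] := filter_ex (filterI (cvgr_dist_lt _ _ (T0P (x j) z) _ e0) UB).
  by rewrite -/v v0 linear0 sub0r normrN ltNge => /negP; apply.
- move=> v e Tv e0.
  have S0 : adherent S 0.
    have [k kE] := SQ (-1) 0%N 0%N.
    have <- : S k = 0 by rewrite kE rmorphN1 scaleN1r addNr.
    exact: adherent_id.
  (* Real convex combinations are only limits of the enumerated operators, so [v] is first
     approximated by some [S i] and then [S i] is nearly normed by some [x k]. *)
  have Sv : adherent S v.
    apply: convex_hull_ind Tv => [_ [n _ <-]|u w t _ Su Sw]; first exact: adherent_id.
    have Sw' := adherent_linear SQ (1 - t) Sw S0; rewrite addr0 in Sw'.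
    exact (adherent_linear SQ t Su Sw').
  have e3 : 0 < e / 3 by rewrite divr_gt0.
  have [i vi] := Sv _ e3; have [n ne] := inv_lt _ e3.
  have [k [xk Sk]] := mP (3%N, 0, n) [:: i].
  exists k; split => //.
  have := le_bop_norm (v - S i) (x k).
  have : `|v - S i| * `|x k| <= `|v - S i| by rewrite ler_piMr.
  have := ler_normD (v - S i) (S i); rewrite subrK.
  have := ler_normB (v (x k)) (v (x k) - S i (x k)).
  rewrite opprB addrC subrK bopB.
  move: Sk ne vi; rewrite -/(S i) -/(x k); move: (n.+1%:R^-1) => t; lra.
Qed.

End null_sequence.

(** * James' theorem on reflexivity *)

Lemma le0_of_small {R : realType} (a C : R) : 0 <= C ->
  (forall e, 0 < e -> a <= e * C) -> a <= 0.
Proof.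
move=> C0 aC; rewrite leNgt; apply/negP => a0.
have C1 : 0 < C + 1 by rewrite ltr_wpDl.
have := aC (a / (C + 1)) (divr_gt0 a0 C1).
by rewrite mulrAC ler_pdivlMr// ler_pM2l// gerDl ler10.
Qed.

Lemma norm_convex_hull_le {R : realType} {V : normedModType R} (A : set V) (M : R) :
  (forall v, A v -> `|v| <= M) -> forall v, convex_hull A v -> `|v| <= M.
Proof.
move=> AM; apply: convex_hull_ind => // x y t /andP[t0 t1] xM yM.
apply: le_trans (ler_normD _ _) _; rewrite !normrZ ger0_norm// ger0_norm ?subr_ge0//.
have : t * `|x| <= t * M by rewrite ler_wpM2l.
have : (1 - t) * `|y| <= (1 - t) * M by rewrite ler_wpM2l// subr_ge0.
lra.
Qed.

Lemma null_convex_block {R : realType} {V : lmodType R} (l : V -> R) (T g : nat -> V) :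
  scalar l -> (l \o T) @ \oo --> (0 : R) -> convex_block T g ->
  (l \o g) @ \oo --> (0 : R).
Proof.
move=> sl T0 Tg; apply/cvgr0Pnorm_lt => e e0.
have [N _ TN] := cvgr0_norm_lt _ T0 _ e0; exists N => // n /= Nn.
have l0 : l 0 = 0 by have := sl (-1) 0 0; rewrite scaler0 addr0; lra.
have lZ a x : l (a *: x) = a * l x by have := sl a x 0; rewrite l0 !addr0.
move: (g n) (Tg n); apply: convex_hull_ind => [_ [m /= nm <-]|x y t /andP[t0 t1] xe ye].
  by apply: TN => /=; exact: leq_trans nm.
rewrite sl lZ; apply: le_lt_trans (ler_normD _ _) _.
rewrite !normrM (ger0_norm t0) (ger0_norm (_ : 0 <= 1 - t)) ?subr_ge0//.
have [->|tn0] := eqVneq t 0; first by rewrite subr0 mul0r add0r mul1r.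
have : t * `|l x| < t * e by rewrite ltr_pM2l// lt_def tn0.
have : (1 - t) * `|l y| <= (1 - t) * e by rewrite ler_wpM2l ?subr_ge0// ltW.
lra.
Qed.

Section reflexivity.
Context {R : realType} {E : completeNormedModType R}.

(** Evaluation is isometric, so approximating points form a Cauchy sequence, and [Phi] is evaluation
    at its limit. *)
Lemma eval_of_approximations (Phi : 'L(E, R^o) -> R) : scalar Phi ->
  (forall t, 0 < t -> exists x, forall f : 'L(E, R^o), Phi f - f x <= t * `|f|) ->
  exists x, forall f : 'L(E, R^o), Phi f = f x.
Proof.
move=> sPhi Phit.
have Phi0 : Phi 0 = 0 by have := sPhi (-1) 0 0; rewrite scaler0 addr0; lra.
have PhiN f : Phi (- f) = - Phi f.
  by have := sPhi (-1) f 0; rewrite Phi0 !addr0 scaleN1r mulN1r.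
pose q : R := 2^-1.
have q01 : 0 < q < 1 by rewrite invr_gt0 invf_lt1 ?ltr0n// ltr1n.
have /andP[q0 q1] := q01.
have qn0 n : 0 < q ^+ n by exact: exprn_gt0.
have /choice[u uP] n := Phit _ (qn0 n).
have uN n (f : 'L(E, R^o)) : `|Phi f - f (u n)| <= q ^+ n * `|f|.
  by rewrite ler_norml uP andbT lerNl opprB; have := uP n (- f);
    rewrite PhiN bopN normrN opprK addrC.
have ucauchy n m : `|u n - u m| <= q ^+ n + q ^+ m.
  have [f f1 <-] := norming_functional (u n - u m).
  have qf k : q ^+ k * `|f| <= q ^+ k by rewrite ler_piMr// ltW.
  have := uN n f; have := uN m f; rewrite linearB !ler_norml.
  by have := qf n; have := qf m => /= h1 h2 /andP[h3 h4] /andP[h5 h6]; lra.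
have ucvg : cvg (u @ \oo).
  apply: cauchy_cvg; apply/cauchyP => e e0.
  have [N NM] := exprn_lt 2 q01 e0.
  exists (u N), N => // m /= Nm; rewrite -ball_normE /=.
  apply: le_lt_trans (ucauchy _ _) _; apply: le_lt_trans (NM _ (leqnn N)).
  have : q ^+ m <= q ^+ N by rewrite ler_wiXn2l ?ltW.
  lra.
exists (lim (u @ \oo)) => f; apply/eqP; rewrite -subr_eq0 -normr_le0.
apply: (@le0_of_small _ _ `|f|) => // e e0.
have e2 : 0 < e / 2 by rewrite divr_gt0.
have [N NM] := exprn_lt 1 q01 e2.
have [n [/= un Nn]] := filter_ex
  (filterI (cvgr_dist_lt _ _ ucvg _ e2) (nbhs_infty_ge N)).
have -> : Phi f - f (lim (u @ \oo)) = Phi f - f (u n) + f (u n - lim (u @ \oo)).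
  by rewrite linearB addrA subrK.
apply: le_trans (ler_normD _ _) _.
have := uN n f; have := le_bop_norm f (u n - lim (u @ \oo)).
have : `|f| * `|u n - lim (u @ \oo)| <= `|f| * (e / 2).
  by rewrite ler_wpM2l// distrC ltW.
have : q ^+ n * `|f| <= e / 2 * `|f|.
  by rewrite ler_wpM2r//; have := NM n Nn; rewrite mul1r => /ltW.
lra.
Qed.

(** This is weak-star compactness of balls in the dual, in the form of limits along ultrafilters. *)
Lemma ultra_functional_limit (g : nat -> 'L(E, R^o)) (U : set_system nat) (M : R) :
  UltraFilter U -> (forall n, `|g n| <= M) ->
  exists w : 'L(E, R^o), forall x, (fun n => g n x : R) @ U --> (w x : R).
Proof.
move=> UU gM.
have M0 : 0 <= M := le_trans (normr_ge0 _) (gM 0%N).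
have gMx x n : `|g n x| <= M * `|x|.
  by apply: le_trans (le_bop_norm _ _) _; rewrite ler_wpM2r.
have /choice[L LP] x : exists l : R, `|l| <= M * `|x| /\ (fun n => g n x : R) @ U --> l.
  by have [l lM gl] := ultra_bounded_cvg UU (gMx x); exists l.
have linL : linear (L : E -> R^o).
  move=> a x y; apply: (cvg_unique (@norm_hausdorff _ R^o) (proj2 (LP _))).
  have : (fun n => a *: (g n x : R^o) + g n y) @ U --> a *: (L x : R^o) + L y.
    by apply: cvgD; [apply: cvgZr|]; exact: (proj2 (LP _)).
  by under eq_fun do rewrite -linearP.
have [w wL] := bop_intro linL (fun x => proj1 (LP x)).
by exists w => x; rewrite wL; exact: (proj2 (LP x)).
Qed.

Lemma between_limits_cvg {V : lmodType R} {B : Type} (ev : B -> V -> R)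
    (g : nat -> V) (w : B -> R) (U : set_system nat) :
  ProperFilter U -> \oo `<=` U -> (forall b, (fun n => ev b (g n)) @ U --> w b) ->
  between_limits ev g w.
Proof.
move=> PU ooU gw b c; split => -[k kc].
  apply: (closed_cvg (fun y => c <= y)) (gw b); first exact: closed_ge.
  by apply: ooU; exists k.
apply: (closed_cvg (fun y => y <= c)) (gw b); first exact: closed_le.
by apply: ooU; exists k.
Qed.

(** A [Phi] that is no evaluation stays at positive distance from evaluations. [Helly_annihilator]
    and [null_sequence] then give functionals violating [james_sequence], with the unit ball of [E]
    as index set [B] and weak-star ultrafilter limits as [w]. *)
Theorem James_reflexive (Phi : 'L(E, R^o) -> R) (C : R) :
  (forall f : 'L(E, R^o), attains_norm f) ->
  scalar Phi -> (forall f, Phi f <= C * `|f|) ->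
  exists x, forall f : 'L(E, R^o), Phi f = f x.
Proof.
move=> attE sPhi PhiC; apply: contrapT => nx.
have [t t0 tP] : exists2 t, 0 < t &
    forall x, exists f : 'L(E, R^o), t * `|f| < Phi f - f x.
  apply: contrapT => /forall2NP nt; apply/nx/eval_of_approximations => // t t0.
  have [//|/existsNP[x /forallNP xt]] := nt t.
  by exists x => f; rewrite leNgt; exact/negP/xt.
(* Helly's argument puts 0 in the weak-star closure of [K], while [Phi] keeps the convex hull of [K]
   away from 0 in norm. *)
pose K : set 'L(E, R^o) := [set f | `|f| <= 1 /\ t < Phi f].
have K_small (s : seq (E * 'L(R^o, R^o))) (e : R) : 0 < e ->
    exists T, K T /\ forall p, p \in s -> `|p.2 (T p.1)| < e.
  move=> e0; have [f [f1 fs tf]] := Helly_annihilator (map fst s) sPhi (ltW t0) tP.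
  exists f; split => // p ps; rewrite fs ?linear0 ?normr0//.
  by apply/mapP; exists p.
have K_cluster (T : nat -> 'L(E, R^o)) (U : set_system nat) :
    UltraFilter U -> (forall n, K (T n)) -> exists T0 : 'L(E, R^o),
    forall x (z : 'L(R^o, R^o)), (fun n => z (T n x) : R) @ U --> (z (T0 x) : R).
  move=> UU KT; have [|w wP] := ultra_functional_limit UU (M := 1) (g := T).
    by move=> n; case: (KT n).
  exists w => x z.
  have zE (r : R^o) : z r = r *: z 1 by rewrite -linearZ/= /GRing.scale/= mulr1.
  rewrite zE; under eq_fun do rewrite zE.
  by apply: (@cvgZl _ R^o); exact: wP.
have [x [c [T [_ _ _ [KT Tnull] Tnorm]]]] := null_sequence 0 K_small K_cluster.
pose C' := `|C| + 1; have C'0 : 0 < C' by rewrite ltr_wpDl.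
pose d := t / C' / 2; have d0 : 0 < d by rewrite !divr_gt0.
have hullK v : convex_hull (tail T 0) v -> 2 * d <= `|v|.
  move=> Tv; have : t <= Phi v.
    apply: (@convex_hull_ind _ _ _ (fun v => t <= Phi v) _ _ v Tv) => [_ [n _ <-]|u w s /andP[s0 s1] ut wt].
      by apply: ltW; case: (KT n).
    have Phi0 : Phi 0 = 0 by have := sPhi (-1) 0 0; rewrite scaler0 addr0; lra.
    have PhiZ a f : Phi (a *: f) = a * Phi f by have := sPhi a f 0; rewrite Phi0 !addr0.
    rewrite sPhi PhiZ; nra.
  rewrite /d mulrC divfK// ler_pdivrMr// => /le_trans; apply.
  apply: le_trans (PhiC v) _; rewrite mulrC ler_wpM2l//.
  by rewrite (le_trans (ler_norm C))// lerDl.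
have T1 n : `|T n| <= 1 by case: (KT n).
pose B := {b : E | `|b| <= 1}.
pose ev (b : B) (f : 'L(E, R^o)) : R := f (sval b).
have ev_scalar b : scalar (ev b) by [].
have ev_le b f : `|ev b f| <= `|f|.
  apply: le_trans (le_bop_norm _ _) _.
  by rewrite ler_piMr//; exact: svalP b.
have lin_id : linear (@id R^o) by [].
have id_le (r : R^o) : `|id r| <= 1 * `|r| by rewrite mul1r.
have [idf idfE] := bop_intro lin_id id_le.
(* Replacing [y] by [- y] if necessary turns an absolute value into a value of [ev]. *)
have ball_opp (f : 'L(E, R^o)) y : `|y| <= 1 ->
    exists b : B, ev b f = `|f y| /\ (sval b = y \/ sval b = - y).
  move=> y1; have [fy|fy] := leP 0 (f y).
    by exists (exist _ y y1); rewrite /ev/= ger0_norm//; split => //; left.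
  have y1' : `|- y| <= 1 by rewrite normrN.
  by exists (exist _ (- y) y1'); rewrite /ev/= linearN ltr0_norm//; split => //; right.
apply: (@james_sequence R _ B ev ev_scalar T 1 d ltr01 d0) => [n b|g Tg].
  exact: le_trans (ev_le _ _) (T1 n).
have g1 n : `|g n| <= 1.
  by apply: norm_convex_hull_le (Tg n) => _ [m _ <-].
have [U [UU ooU]] := ultra_infty.
have [w wP] := ultra_functional_limit UU g1.
exists (fun b => ev b w); split.
- by apply: between_limits_cvg ooU _ => b; exact: wP.
- move=> v Tv; have [k [xk1 vk]] := Tnorm v d Tv d0.
  have [b [bE bx]] := ball_opp v (x k) xk1; exists b.
  (* The limit [w] may be nonzero, but it vanishes at each [x k], and these points norm the convex
     combinations of the [T n]. *)
  have wx : w (x k) = 0.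
    apply: (cvg_unique (@norm_hausdorff _ R^o) (wP (x k))) => A A0; apply: ooU.
    have Tx0 : (fun n => T n (x k) : R) @ \oo --> (0 : R).
      by have := Tnull k idf; under eq_fun do rewrite idfE.
    exact: (null_convex_block (l := fun f : 'L(E, R^o) => f (x k)) _ Tx0 Tg).
  have -> : ev b w = 0.
    by rewrite /ev; case: bx => ->; [exact: wx|rewrite linearN/= wx oppr0].
  by rewrite bE; have := hullK v Tv; lra.
- move=> q q01; have [s sP] := geometric_sum q01 g1.
  (* Norm attainment is applied to [s - w], itself a functional, where [s] is the sum of the
     series. *)
  have [y [y1 yE]] := attE (s - w); have [b0 [b0E _]] := ball_opp (s - w) y y1.
  exists (fun b => ev b s), b0; split=> [n b|b].
    by have := sP n; apply: le_trans; rewrite -[_ - _]/(ev b (s - _)).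
  rewrite -[_ - _]/(ev b (s - w)) -[leRHS]/(ev b0 (s - w)) b0E yE.
  by apply: le_trans (ler_norm _) _; exact: ev_le.
Qed.

End reflexivity.

(** * Complemented separable subspaces *)

Lemma adherent_closed {R : realType} {V : normedModType R} (v : nat -> V) (y : V) :
  (forall e, 0 < e -> exists2 z, adherent v z & `|y - z| < e) -> adherent v y.
Proof.
move=> yv e e0; have e2 : 0 < e / 2 by rewrite divr_gt0.
have [z vz yz] := yv _ e2; have [i zi] := vz _ e2; exists i.
by rewrite -[y - v i](subrKA z); have := ler_normD (y - z) (z - v i); lra.
Qed.

Section projection.
Context {R : realType} {E : completeNormedModType R} (J : 'L(E, E)).
Variables (x : nat -> E) (c : nat -> 'L(E, R^o)).
Hypothesis reflE : forall Xi : 'L('L(E, R^o), R^o),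
  exists x0, forall f : 'L(E, R^o), Xi f = f x0.
Hypotheses (xQ : rational_closed x) (cQ : rational_closed c).
Hypothesis xJ : forall i, exists k, x k = J (x i).
Hypothesis cJ : forall i, exists k, forall z, c k z = c i (J z).
Hypothesis c_norming : forall i, exists k, `|c k| <= 1 /\ c k (x i) = `|x i|.
Hypothesis x_norming : forall i (e : R), 0 < e ->
  exists k, `|x k| <= 1 /\ `|c i| - e < `|c i (x k)|.

Let N z := forall i, c i z = 0.

Let N_linear a y z : N y -> N z -> N (a *: y + z).
Proof. by move=> Ny Nz i; rewrite linearP/= Ny Nz scaler0 addr0. Qed.

Let x_linear := adherent_linear xQ.

Let x0 : adherent x 0.
Proof.
have := x_linear (-1) (adherent_id x 0%N) (adherent_id x 0%N).
by rewrite scaleN1r addNr.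
Qed.

Let N0 : N 0. Proof. by move=> i; rewrite linear0. Qed.

(** Some [c k] of norm at most 1 norms a nearby [x i] and kills [z]. This makes the sum direct and
    bounds the projection by 1. *)
Let norm_le_add y z : adherent x y -> N z -> `|y| <= `|y + z|.
Proof.
move=> xy Nz; apply/ler_addgt0Pr => e e0.
have e2 : 0 < e / 2 by rewrite divr_gt0.
have [i yi] := xy _ e2; have [k [ck1 ckx]] := c_norming i.
have : `|x i| <= `|x i + z|.
  rewrite -ckx -[c k _]addr0 -(Nz k) -linearD; apply: le_trans (ler_norm _) _.
  by apply: le_trans (le_bop_norm _ _) _; rewrite ler_piMl.
have := ler_normD (y - x i) (x i); rewrite subrK.
have := ler_normB (y + z) (y - x i).
have -> : y + z - (y - x i) = x i + z by rewrite opprB addrC addrA subrK.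
lra.
Qed.

(* A functional vanishing on both summands is a norm limit of the [c i], because by
   reflexivity no bidual element separates it from them; it is then 0 because the
   [x k] norm the [c i]. *)
Let dense_sum u (e : R) : 0 < e ->
  exists y z, [/\ adherent x y, N z & `|u - (y + z)| < e].
Proof.
move=> e0; apply: contrapT => nu.
pose A : set E := [set v | exists y z, [/\ adherent x y, N z & v = y + z]].
have A0 : A !=set0 by exists 0, 0, 0; rewrite addr0.
have AL a v w : A v -> A w -> A (a *: v + w).
  move=> [y [z [xy Nz ->]]] [y' [z' [xy' Nz' ->]]].
  exists (a *: y + y'), (a *: z + z'); split; [exact: x_linear|exact: N_linear|].
  by rewrite scalerDr addrACA.
have Ae v : A v -> e <= `|u - v|.
  move=> [y [z [xy Nz ->]]]; rewrite leNgt; apply/negP => ue.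
  by apply: nu; exists y, z.
have [f [fA /negP]] := separating_functional A0 AL e0 Ae; apply; apply/eqP.
have fx y : adherent x y -> f y = 0.
  by move=> xy; apply: fA; exists y, 0; rewrite addr0.
have fN z : N z -> f z = 0 by move=> Nz; apply: fA; exists 0, z; rewrite add0r.
have cf : adherent c f.
  apply: contrapT => /(separating_adherent cQ)[Xi [Xic /negP]]; apply; apply/eqP.
  have [y0 Xiy] := reflE Xi; rewrite Xiy; apply: fN => i.
  by rewrite -Xiy; exact: Xic.
suff f0 : `|f| <= 0.
  by apply/eqP; rewrite -normr_le0 (le_trans (le_bop_norm _ _))//
    (le_trans (ler_wpM2r _ f0))// mul0r.
apply/ler_addgt0Pr => d d0; rewrite add0r.
have d3 : 0 < d / 3 by rewrite divr_gt0.
have [i fi] := cf _ d3; have [k [xk1 ck]] := x_norming i d3.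
have := le_bop_norm (f - c i) (x k); rewrite bopB (fx (x k)) ?sub0r ?normrN; last first.
  exact: adherent_id.
have : `|f - c i| * `|x k| <= `|f - c i| by rewrite ler_piMr.
by have := ler_normD (f - c i) (c i); rewrite subrK; lra.
Qed.

(** By [norm_le_add] the first summands of the approximations from [dense_sum] form a Cauchy
    sequence, so the dense sum is the whole space. *)
Let decomposition u : exists2 y, adherent x y & N (u - y).
Proof.
pose q : R := 2^-1.
have q01 : 0 < q < 1 by rewrite invr_gt0 invf_lt1 ?ltr0n// ltr1n.
have /andP[q0 q1] := q01.
have qn0 n : 0 < q ^+ n by exact: exprn_gt0.
have /choice[y yP] n : exists y, exists z, [/\ adherent x y, N z & `|u - (y + z)| < q ^+ n].
  exact: dense_sum.
have xy n : adherent x (y n) by case: (yP n) => z [].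
have ydist n m : `|y n - y m| <= q ^+ n + q ^+ m.
  have [z [_ Nz uz]] := yP n; have [z' [_ Nz' uz']] := yP m.
  have xyy : adherent x (y n - y m).
    by rewrite addrC -scaleN1r; apply: x_linear.
  have Nzz : N (z - z') by rewrite addrC -scaleN1r; apply: N_linear.
  apply: le_trans (norm_le_add xyy Nzz) _.
  have -> : y n - y m + (z - z') = (u - (y m + z')) - (u - (y n + z)).
    by rewrite opprB [RHS]addrC subrKA opprD addrACA.
  by have := ler_normB (u - (y m + z')) (u - (y n + z)); lra.
have ycvg : cvg (y @ \oo).
  apply: cauchy_cvg; apply/cauchyP => e e0.
  have [M HM] := exprn_lt 2 q01 e0.
  exists (y M), M => // m /= Mm; rewrite -ball_normE /=.
  apply: le_lt_trans (ydist _ _) _; apply: le_lt_trans (HM _ (leqnn M)).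
  have : q ^+ m <= q ^+ M by rewrite ler_wiXn2l ?ltW.
  lra.
exists (lim (y @ \oo)).
  apply: adherent_closed => e e0.
  by have [n yn] := filter_ex (cvgr_dist_lt _ _ ycvg _ e0); exists (y n).
move=> i; apply/eqP; rewrite -normr_le0.
apply: (@le0_of_small _ _ `|c i|) => // e e0.
have e2 : 0 < e / 2 by rewrite divr_gt0.
have [M HM] := exprn_lt 1 q01 e2.
have [n [/= yn Mn]] := filter_ex
  (filterI (cvgr_dist_lt _ _ ycvg _ e2) (nbhs_infty_ge M)).
have [z [_ Nz uz]] := yP n; have := HM n Mn; rewrite mul1r => qe.
rewrite -[c i _]subr0 -(Nz i) -linearB; apply: le_trans (le_bop_norm _ _) _.
rewrite mulrC ler_wpM2r//.
have -> : u - lim (y @ \oo) - z = (u - (y n + z)) - (lim (y @ \oo) - y n).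
  by rewrite opprB opprD [- y n - z]addrC [u + (- z - y n)]addrA subrKA addrAC.
have := ler_normB (u - (y n + z)) (lim (y @ \oo) - y n); lra.
Qed.

(** Uniqueness of the decomposition gives linearity; it gives commutation with [J] because [J]
    preserves both summands, by [xJ] and [cJ]. *)
Lemma projection : exists P : 'L(E, E), [/\ forall u, adherent x (P u),
  forall y, adherent x y -> P y = y & forall u, P (J u) = J (P u)].
Proof.
have /choice[P PP] u : exists y, adherent x y /\ N (u - y).
  by have [y ? ?] := decomposition u; exists y.
have uniq u y : adherent x y -> N (u - y) -> y = P u.
  move=> xy Ny; have [xP NP] := PP u; apply/eqP; rewrite -subr_eq0 -normr_le0.
  have xyP : adherent x (y - P u) by rewrite addrC -scaleN1r; apply: x_linear.
  have NyP : N ((u - y) - (u - P u)) by rewrite addrC -scaleN1r; apply: N_linear.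
  apply: le_trans (norm_le_add xyP NyP) _.
  by rewrite opprB [u - y + _]addrC subrKA subrKA subrr normr0.
have linP : linear P.
  move=> a u v; have [xu Nu] := PP u; have [xv Nv] := PP v.
  apply/esym/uniq; first exact: x_linear.
  have -> : a *: u + v - (a *: P u + P v) = a *: (u - P u) + (v - P v).
    by rewrite scalerBr opprD addrACA.
  exact: N_linear.
have Ple u : `|P u| <= 1 * `|u|.
  have [xP NP] := PP u; rewrite mul1r; apply: le_trans (norm_le_add xP NP) _.
  by rewrite addrC subrK.
have [Q QE] := bop_intro linP Ple.
exists Q; split => [u|y xy|u]; rewrite !QE.
- by case: (PP u).
- by apply/esym/uniq => //; rewrite subrr.
- have [xP NP] := PP u; apply/esym/uniq; last first.
    by move=> i; rewrite -linearB; have [k <-] := cJ i; exact: NP.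
  move=> e e0; have J0 : 0 < `|J| + 1 by rewrite ltr_wpDl.
  have [i iP] := xP _ (divr_gt0 e0 J0); have [k kE] := xJ i; exists k.
  rewrite kE -linearB; apply: le_lt_trans (le_bop_norm _ _) _.
  move: iP; rewrite ltr_pdivlMr// => iP; apply: le_lt_trans iP.
  by rewrite mulrC ler_wpM2l// lerDl.
Qed.

End projection.

(** * Operators intertwining two given operators *)

Section boundedness.
Context {R : realType}.

Lemma bop_norm_le_ball {E F : normedModType R} (T : 'L(E, F)) (M : R) :
  (forall x, `|x| <= 1 -> `|T x| <= M) -> `|T| <= M.
Proof.
move=> TM; apply: ge_sup; first by case: (opnorm_has_sup T).
by move=> _ [x /= x1 <-]; exact: TM.
Qed.

Lemma bop_bounded_fun {E F : normedModType R} (T : 'L(E, F)) : bounded_fun_norm T.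
Proof.
move=> r; exists (`|T| * r) => x xr; apply: le_trans (le_bop_norm _ _) _.
by rewrite ler_wpM2l.
Qed.

Lemma bop_pointwise_bounded {E : completeNormedModType R} {F : normedModType R}
    (I : Type) (T : I -> 'L(E, F)) :
  (forall x, exists M, forall i, `|T i x| <= M) -> exists M, forall i, `|T i| <= M.
Proof.
move=> Tx; have [||M MP] := @Banach_Steinhauss R E F [set (T i : E -> F) | i in setT] _ _ 1.
- by move=> _ [i _ <-]; split; [exact: bop_bounded_fun|exact: linearP].
- by move=> x; have [M MP] := Tx x; exists M => _ [i _ <-].
- by exists M => i; apply: bop_norm_le_ball => x x1; apply: MP => //; exists i.
Qed.

(** Uniform boundedness is used twice: for the evaluations at [T i x] on the dual of [F], then for
    the operators [T i] on [E]. *)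
Lemma bop_weakly_bounded {E F : completeNormedModType R} (I : Type) (T : I -> 'L(E, F)) :
  (forall x (z : 'L(F, R^o)), exists M, forall i, `|z (T i x)| <= M) ->
  exists M, forall i, `|T i| <= M.
Proof.
move=> Txz; apply: bop_pointwise_bounded => x.
have le1 i (z : 'L(F, R^o)) : `|z (T i x) : R^o| <= `|T i x| * `|z|.
  by rewrite mulrC le_bop_norm.
have lin1 i : linear (fun z : 'L(F, R^o) => z (T i x) : R^o) by [].
have /choice[ev evE] i := bop_intro (lin1 i) (le1 i).
have [|M MP] := @bop_pointwise_bounded 'L(F, R^o) R^o I ev.
  by move=> z; have [M MP] := Txz x z; exists M => i; rewrite evE.
exists M => i; have [z z1 zE] := norming_functional (T i x).
rewrite -zE -evE; apply: le_trans (ler_norm _) _; apply: le_trans (le_bop_norm _ _) _.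
by rewrite (le_trans _ (MP i))// ler_piMr.
Qed.

End boundedness.

Section intertwining_operators.
Context {R : realType} {E F : completeNormedModType R} (JE : 'L(E, E)) (JF : 'L(F, F)).

(** Taking identities gives all operators; taking multiplication by i on both sides gives the
    complex linear ones. *)
Definition intertwines (T : 'L(E, F)) := forall x, T (JE x) = JF (T x).

Lemma intertwinesD S T : intertwines S -> intertwines T -> intertwines (S + T).
Proof. by move=> SJ TJ x; rewrite !bopD SJ TJ linearD. Qed.

Lemma intertwinesZ a T : intertwines T -> intertwines (a *: T).
Proof. by move=> TJ x; rewrite !bopZ TJ linearZ. Qed.

Lemma intertwines_closed T :
  (forall e, 0 < e -> exists2 S, intertwines S & `|T - S| <= e) -> intertwines T.
Proof.
move=> TS x; apply/eqP; rewrite -subr_eq0 -normr_le0.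
apply: (@le0_of_small _ _ (`|JE x| + `|JF| * `|x|)).
  by rewrite addr_ge0// mulr_ge0.
move=> e e0; have [S SJ STe] := TS e e0.
have -> : T (JE x) - JF (T x) = (T - S) (JE x) - JF ((T - S) x).
  by rewrite !bopB linearB SJ opprB subrKA.
apply: le_trans (ler_normB _ _) _.
have := le_bop_norm (T - S) (JE x); have := le_bop_norm JF ((T - S) x).
have : `|JF| * `|(T - S) x| <= `|JF| * (e * `|x|).
  by rewrite ler_wpM2l// (le_trans (le_bop_norm _ _))// ler_wpM2r.
have : `|T - S| * `|JE x| <= e * `|JE x| by rewrite ler_wpM2r.
lra.
Qed.

Variable K : set 'L(E, F).

(** Were all intertwiners norm attaining, [james_sequence] would fail for the operators [T n]
    composed with the projection, with [w = 0]. Commutation of the projection with [JE] keeps the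
    construction among intertwiners. *)
Theorem non_norm_attaining_intertwiner :
  (forall T, K T -> intertwines T) ->
  (forall (s : seq (E * 'L(F, R^o))) (e : R), 0 < e ->
    exists T, K T /\ forall p, p \in s -> `|p.2 (T p.1)| < e) ->
  (forall (T : nat -> 'L(E, F)) (U : set_system nat), UltraFilter U ->
    (forall n, K (T n)) -> exists T0 : 'L(E, F),
    forall x (z : 'L(F, R^o)), (fun n => z (T n x) : R) @ U --> (z (T0 x) : R)) ->
  (exists2 d, 0 < d & forall T, convex_hull K T -> d <= `|T|) ->
  (forall f : 'L(E, R^o), attains_norm f) ->
  exists T, intertwines T /\ ~ attains_norm T.
Proof.
move=> KJ K_small K_cluster [d d0 Kd] attE; apply: contrapT => /forallNP natt.
have att T : intertwines T -> attains_norm T.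
  by move=> TJ; apply: contrapT => nT; apply: (natt T).
have [x [c [T [[xQ cQ] [xJ cJ] [c_nrm x_nrm] [KT Tnull] Tnorm]]]] :=
  null_sequence JE K_small K_cluster.
have reflE (Xi : 'L('L(E, R^o), R^o)) : exists x0, forall f : 'L(E, R^o), Xi f = f x0.
  apply: (@James_reflexive _ _ (Xi : _ -> R) `|Xi|) => //.
    by move=> a f g; rewrite linearP.
  by move=> f; apply: le_trans (ler_norm _) _; exact: le_bop_norm.
have [P [xP Pid PJ]] := projection reflE xQ cQ xJ cJ c_nrm x_nrm.
(* An unbounded orbit would have a sequence of values exceeding every [m], which no ultrafilter
   limit from [K_cluster] allows. *)
have T_bounded : exists M, forall n, `|T n| <= M.
  apply: bop_weakly_bounded => y z; apply: contrapT => /forallNP unb.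
  have /choice[n_ n_P] m : exists n, m%:R < `|z (T n y)|.
    apply: contrapT => /forallNP nm; apply: (unb m%:R) => n.
    by rewrite leNgt; apply/negP; exact: nm.
  have [U [UU ooU]] := ultra_infty.
  have [T0 T0P] := K_cluster (T \o n_) U UU (fun m => KT (n_ m)).
  have [m [/= m1 m2]] := filter_ex (filterI (cvgr_dist_lt _ _ (T0P y z) _ ltr01)
    (ooU _ (nbhs_infty_ge (Num.truncn (`|z (T0 y)| + 1)).+1))).
  have := n_P m; have := truncnS_gt (`|z (T0 y)| + 1).
  have : (Num.truncn (`|z (T0 y)| + 1)).+1%:R <= m%:R :> R by rewrite ler_nat.
  have := ler_normB (z (T0 y)) (z (T0 y) - z (T (n_ m) y)).
  by rewrite subKr; lra.
have [M0 TM0] := T_bounded.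
pose M := `|M0| + 1; have Mpos : 0 < M by rewrite ltr_wpDl.
have TM n : `|T n| <= M.
  by rewrite (le_trans (TM0 n))// (le_trans (ler_norm _))// lerDl.
(* The [T n] are known to tend to 0 only at the [x i]; after composition with [P] they do so weakly
   at every vector. *)
have /choice[T' T'E] n : exists T' : 'L(E, F), forall y, T' y = T n (P y).
  by have [C _ CE] := bop_comp (T n) P; exists C.
have [MP MP0 T'M] : exists2 MP, 0 < MP & forall n, `|T' n| <= MP.
  exists (M * (`|P| + 1)) => [|n]; first by rewrite mulr_gt0// ltr_wpDl.
  apply: bop_norm_le => [|y]; first by rewrite mulr_ge0 ?addr_ge0// ltW.
  rewrite T'E; apply: le_trans (le_bop_norm _ _) _; rewrite -mulrA ler_pM//.
  by apply: le_trans (le_bop_norm _ _) _; rewrite ler_wpM2r// lerDl.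
have T'J n : intertwines (T' n).
  by move=> y; rewrite !T'E PJ (KJ _ (KT n)).
have T'null y (z : 'L(F, R^o)) : (fun n => z (T' n y) : R) @ \oo --> (0 : R).
  apply/cvgr0Pnorm_lt => e e0.
  pose C := `|z| * M; have C0 : 0 < C + 1 by rewrite ltr_wpDl// mulr_ge0// ltW.
  have e2 : 0 < e / 2 by rewrite divr_gt0.
  have [i iP] := xP y _ (divr_gt0 e2 C0).
  apply: filterS (cvgr0_norm_lt _ (Tnull i z) _ e2) => n /= Tn.
  have -> : z (T' n y) = z (T n (P y - x i)) + z (T n (x i)).
    by rewrite T'E -linearD -linearD subrK.
  apply: le_lt_trans (ler_normD _ _) _.
  have := le_bop_norm z (T n (P y - x i)).
  have : `|z| * `|T n (P y - x i)| <= `|z| * (M * `|P y - x i|).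
    by rewrite ler_wpM2l// (le_trans (le_bop_norm _ _))// ler_wpM2r.
  move: iP; rewrite ltr_pdivlMr// mulrDr mulr1 /C.
  by have := normr_ge0 (P y - x i); lra.
(* This set is a boundary for intertwiners: a vector where the norm is attained, paired with a
   functional norming its image, maximizes [ev]. *)
pose B := ({y : E | `|y| <= 1} * {z : 'L(F, R^o) | `|z| <= 1})%type.
pose ev (b : B) (S : 'L(E, F)) : R := sval b.2 (S (sval b.1)).
have ev_scalar b : scalar (ev b) by move=> a S S'; rewrite /ev bopD bopZ linearP.
have ev_le b S : `|ev b S| <= `|S|.
  have z1 := svalP b.2; have y1 := svalP b.1.
  have h1 : `|ev b S| <= `|S (sval b.1)|.
    by apply: le_trans (le_bop_norm _ _) _; rewrite ler_piMl.
  by apply: le_trans h1 _; apply: le_trans (le_bop_norm _ _) _; rewrite ler_piMr.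
have ev_ex (S : 'L(E, F)) y : `|y| <= 1 -> exists b, ev b S = `|S y|.
  move=> y1; have [z z1 zE] := norming_functional (S y).
  by exists (exist _ y y1, exist _ z z1).
have d2 : 0 < d / 2 by rewrite divr_gt0.
apply: (@james_sequence R _ B ev ev_scalar T' MP (d / 2) MP0 d2) => [n b|g T'g].
  exact: le_trans (ev_le _ _) (T'M n).
have gM n : `|g n| <= MP.
  by apply: norm_convex_hull_le (T'g n) => _ [m _ <-].
have gJ n : intertwines (g n).
  apply: (@convex_hull_ind _ _ _ intertwines _ _ _ (T'g n)) => [_ [m _ <-] //|S S' t _ SJ SJ'].
  by apply: intertwinesD; exact: intertwinesZ.
exists (fun=> 0); split.
- apply: (@between_limits_cvg _ _ _ ev g (fun=> 0) \oo) => // b.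
  by apply: null_convex_block T'g; [exact: ev_scalar|exact: T'null].
- move=> S T'S.
  (* A convex combination of the [T' n] is one of the [T n] followed after [P]; both agree at each
     [x k], where the norm of [S'] is nearly reached. *)
  have [S' [TS' SE]] : exists S', convex_hull (tail T 0) S' /\ forall y, S y = S' (P y).
    apply: (@convex_hull_ind _ _ _ (fun S : 'L(E, F) => exists S' : 'L(E, F),
      convex_hull (tail T 0) S' /\ forall y, S y = S' (P y)) _ _ _ T'S).
      move=> _ [n _ <-]; exists (T n); split; last exact: T'E.
      by apply: sub_convex_hull; exists n.
    move=> S1 S2 t t01 [S1' [h1 e1]] [S2' [h2 e2]].
    exists (t *: S1' + (1 - t) *: S2'); split; first exact: convex_hull_conv.
    by move=> y; rewrite !bopD !bopZ e1 e2.
  have [k [xk1 Sk]] := Tnorm S' _ TS' d2.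
  have [b bE] := ev_ex S (x k) xk1; exists b; rewrite bE subr0 SE Pid; last first.
    exact: adherent_id.
  have : d <= `|S'|.
    apply: Kd; apply: convex_hull_sub TS' => _ [n _ <-]; exact: sub_convex_hull.
  lra.
- move=> q q01; have [s sP] := geometric_sum q01 gM.
  (* The sum is a norm limit of intertwiners, so norm attainment may be applied to it. *)
  have sJ : intertwines s.
    apply: intertwines_closed => e e0.
    have [N NM] := exprn_lt MP q01 e0.
    exists (\sum_(i < N) (q ^+ i * (1 - q)) *: g i); last first.
      exact: le_trans (sP N) (ltW (NM _ (leqnn N))).
    elim/big_ind: _ => [y|S S'|i _].
    + by rewrite !bop0 linear0.
    + exact: intertwinesD.
    + exact: intertwinesZ.
  have [y [y1 yE]] := att s sJ; have [b0 b0E] := ev_ex s y y1.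
  exists (fun b => ev b s), b0; split=> [n b|b].
    have -> : ev b s - ev b (\sum_(i < n) (q ^+ i * (1 - q)) *: g i) =
        ev b (s - \sum_(i < n) (q ^+ i * (1 - q)) *: g i).
      by rewrite /ev bopB linearB.
    exact: le_trans (ev_le _ _) (sP n).
  by rewrite lerD2r b0E yE; apply: le_trans (ler_norm _) _; exact: ev_le.
Qed.

End intertwining_operators.

(** * Real scalars *)

Section weak_operator_topology.
Context {K : numFieldType} {E F : normedModType K} (A : set 'L(E, F)).

(** The conditions for the pairs in [s] define a neighbourhood of 0, by induction on finite
    intersections. *)
Lemma wot_closure_small (s : seq (E * dual F)) (e : K) :
  closure (A : set (wot E F)) (0 : 'L(E, F)) -> 0 < e ->
  exists T, A T /\ forall p, p \in s -> `|p.2 (T p.1)| < e.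
Proof.
move=> A0 e0; have [|T [AT Ts]] := A0 [set T | forall p, p \in s -> `|p.2 ((T : 'L(E, F)) p.1)| < e];
  last by exists T.
elim: s => [|p s IH]; first exact: filterE.
have /wot_cvgP/(_ p.1 p.2) : nbhs (0 : wot E F) --> (0 : wot E F) by [].
have -> : (0 : 'L(E, F)) p.1 = 0 by [].
rewrite linear0 => /cvgr0_norm_lt /(_ e e0) ps.
apply: filterS2 ps IH => T Tp Ts r; rewrite inE => /predU1P[->|/Ts//].
exact: Tp.
Qed.

Lemma wot_ultra_cluster (T : nat -> 'L(E, F)) (U : set_system nat) :
  compact (closure (A : set (wot E F))) -> UltraFilter U -> (forall n, A (T n)) ->
  exists T0 : 'L(E, F), forall x (z : dual F), (fun n => z (T n x)) @ U --> z (T0 x).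
Proof.
move=> cA UU AT.
have [|T0 _ TT0] := @ultra_compact_cvg (wot E F) _ _ U T UU cA.
  by apply: filterE => n; apply: subset_closure; exact: AT.
exists T0 => x z.
by have /wot_cvgP/(_ x z) := TT0.
Qed.

End weak_operator_topology.

Section real_scalars.
Context {R : realType}.

Lemma nonzero_value {E F : normedModType R} (T : 'L(E, F)) :
  0 < `|T| -> exists x, T x != 0.
Proof.
move=> T0; apply: contrapT => /forallNP Tx; move: T0; apply/negP.
rewrite -leNgt normr_le0; apply/eqP/bop_ext => x.
by apply/eqP/negPn/negP; exact: Tx.
Qed.

Lemma attains_normP {E F : normedModType R} (T : 'L(E, F)) (x : E) : `|x| <= 1 ->
  (forall y, `|y| <= 1 -> `|T y| <= `|T x|) -> attains_norm T.
Proof.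
move=> x1 Tx; exists x; split => //; apply/eqP; rewrite eq_le; apply/andP; split.
  by apply: le_trans (le_opnorm T x) _; rewrite ler_piMr ?opnorm_ge0.
exact: bop_norm_le_ball.
Qed.

Lemma le_attained_norm {E F : normedModType R} (T : 'L(E, F)) : attains_norm T ->
  exists2 x, `|x| <= 1 & forall y, `|y| <= 1 -> `|T y| <= `|T x|.
Proof.
move=> [x [x1 Tx]]; exists x => // y y1; rewrite Tx.
by apply: le_trans (le_opnorm T y) _; rewrite ler_piMr ?opnorm_ge0.
Qed.

(** With identities for [JE] and [JF] every operator intertwines. Functionals attain their norms
    because rank-one operators do. *)
Theorem James_property_real (E F : completeNormedModType R) :
  James_property E F -> exists T : 'L(E, F), ~ attains_norm T.
Proof.
move=> [A [cA A0 Afar]]; apply: contrapT => /forallNP natt.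
have att (T : 'L(E, F)) : attains_norm T by apply: contrapT => nT; exact: (natt T nT).
have [d d0 Ad] : exists2 d, 0 < d & forall T, convex_hull A T -> d <= `|T|.
  move: Afar => /existsNP[d /not_implyP[d0 Ad]]; exists d => // T AT.
  rewrite leNgt; apply/negP => Td; apply: Ad; exists T; split => //.
  by rewrite /ball_/= sub0r -[opnorm _]/(`|- T|) normrN.
have [T0 [AT0 _]] := wot_closure_small [::] A0 ltr01.
have [x0 Tx0] := nonzero_value (lt_le_trans d0 (Ad _ (sub_convex_hull AT0))).
have id_lin : linear (@id E) by [].
have id_le (x : E) : `|id x| <= 1 * `|x| by rewrite mul1r.
have [JE JEE] := bop_intro id_lin id_le.
have idF_lin : linear (@id F) by [].
have idF_le (x : F) : `|id x| <= 1 * `|x| by rewrite mul1r.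
have [JF JFE] := bop_intro idF_lin idF_le.
have [||||f|T [_ nT]] := @non_norm_attaining_intertwiner R E F JE JF A.
- by move=> T _ x; rewrite JEE JFE.
- by move=> s e; exact: wot_closure_small.
- by move=> T U UU; exact: wot_ultra_cluster.
- by exists d.
(* The vector [T0 x0] is nonzero, so the rank-one operator and [f] attain their norms at the same
   point. *)
- have lin : linear (fun x => f x *: T0 x0).
    by move=> a x y; rewrite linearP/= scalerDl scalerA.
  have le x : `|f x *: T0 x0| <= `|f| * `|T0 x0| * `|x|.
    by rewrite normrZ mulrAC ler_wpM2r// le_bop_norm.
  have [T TE] := bop_intro lin le.
  have [x x1 Tx] := le_attained_norm (att T).
  apply: (attains_normP x1) => y /Tx.
  by rewrite !TE !normrZ ler_pM2r// normr_gt0.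
- exact: nT (att T).
Qed.

End real_scalars.

(** * Complex scalars *)

Import ComplexField.
Local Open Scope complex_scope.

Section real_part.
Context {R : realType}.
Implicit Types z : R[i].

Lemma Re_normK {V : normedZmodType R[i]} (x : V) : (complex.Re `|x|)%:C = `|x|.
Proof. by rewrite RRe_real// normr_real. Qed.

Lemma Re_le z1 z2 : z1 <= z2 -> complex.Re z1 <= complex.Re z2.
Proof. by rewrite lecE => /andP[]. Qed.

Lemma Re_norm z : `|complex.Re z| <= complex.Re `|z|.
Proof. by rewrite -lecR Re_normK normc_ge_Re. Qed.

Lemma norm_real_complex (a : R) : `|a%:C| = `|a|%:C.
Proof. by rewrite normc_def /= expr0n addr0 sqrtr_sqr. Qed.

Lemma scale_complexE {V : lmodType R[i]} z (x : V) :
  z *: x = (complex.Re z)%:C *: x + (complex.Im z)%:C *: ('i%C *: x).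
Proof. by rewrite scalerA -scalerDl mulrC -complexE. Qed.

End real_part.

(** An alias of the carrier, so that the real structure does not clash with the complex one. *)
Definition realification (R : realType) (V : normedModType R[i]) : Type := V.

Section realification.
Context {R : realType} (V : normedModType R[i]).
Local Notation W := (realification V).

HB.instance Definition _ := GRing.Zmodule.copy W V.

Let scale (a : R) (x : W) : W := a%:C *: (x : V).

Let scaleA a b v : scale a (scale b v) = scale (a * b) v.
Proof. by rewrite /scale scalerA rmorphM. Qed.

Let scale1 : left_id 1 scale.
Proof. by move=> v; rewrite /scale rmorph1 scale1r. Qed.

Let scaleDr : right_distributive scale +%R.
Proof. by move=> a x y; exact: scalerDr. Qed.

Let scaleDl v : {morph scale^~ v : a b / a + b}.
Proof. by move=> a b; rewrite /scale rmorphD; exact: scalerDl. Qed.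

HB.instance Definition _ :=
  GRing.Zmodule_isLmodule.Build R W scaleA scale1 scaleDr scaleDl.

Let norm (x : W) : R := complex.Re `|x : V|.

Let normD (x y : W) : norm (x + y) <= norm x + norm y.
Proof. by rewrite /norm -raddfD; apply: Re_le; exact: ler_normD. Qed.

Let normZ (a : R) (x : W) : norm (a *: x) = `|a| * norm x.
Proof.
by apply: (@complexI R); rewrite /norm rmorphM/= !Re_normK normrZ norm_real_complex.
Qed.

Let norm_eq0 (x : W) : norm x = 0 -> x = 0.
Proof.
by move=> /(congr1 (fun r => r%:C)); rewrite Re_normK => /eqP; rewrite normr_eq0 => /eqP.
Qed.

HB.instance Definition _ := Lmodule_isNormed.Build R W normD normZ norm_eq0.

Lemma realification_normE (x : V) : (`|x : W|)%:C = `|x|.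
Proof. exact: Re_normK. Qed.

End realification.

Section realification_complete.
Context {R : realType} (V : completeNormedModType R[i]).
Local Notation W := (realification V).

Lemma realification_complete (G : set_system W) :
  ProperFilter G -> cauchy G -> cvg G.
Proof.
move=> PG /cauchyP cG.
have cGV : cauchy (G : set_system V).
  apply/cauchyP => e e0.
  have eE : (complex.Re e)%:C = e by rewrite RRe_real// gtr0_real.
  have e0' : 0 < complex.Re e by rewrite -ltcR eE.
  have [x Gx] := cG _ e0'; exists x.
  apply: (@filterS _ G _ _ _ _ Gx) => y.
  by rewrite -!ball_normE /= -ltcR eE realification_normE.
have cvgV : cvg (G : set_system V) by exact: cauchy_cvg.
apply/cvg_ex; exists (lim (G : set_system V)); apply/cvg_ballP => e e0.
have e0' : 0 < e%:C by rewrite ltcR.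
have /cvg_ballP/(_ _ e0') := cvgV.
apply: (@filterS _ G) => y.
by rewrite -!ball_normE /= -[_ < e]ltcR realification_normE.
Qed.

HB.instance Definition _ := Uniform_isComplete.Build W realification_complete.

End realification_complete.

Section realified_operators.
Context {R : realType} {E F : normedModType R[i]}.
Local Notation Er := (realification E).
Local Notation Fr := (realification F).

Lemma realify (T : 'L(E, F)) : exists S : 'L(Er, Fr), forall x, S x = T x.
Proof.
have [_ [M TM]] := bounded_linearP _ (valP T).
have [m mE] : exists m, m%:C = `|M| by exists (complex.Re `|M|); exact: Re_normK.
apply: (@bop_intro R Er Fr T m).
  by move=> a x y; rewrite -[a *: _]/(a%:C *: (_ : E)) linearP.
move=> x; rewrite -lecR rmorphM/= mE !realification_normE.
(* The bound [M] is a complex number; a nonzero [x] forces it to be nonnegative and so equal to its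
   modulus. *)
have [->|x0] := eqVneq (x : E) 0; first by rewrite linear0 !normr0 mulr0.
rewrite ger0_norm; first exact: TM.
by rewrite -(@pmulr_lge0 _ `|x : E|) ?normr_gt0// (le_trans _ (TM x)).
Qed.

(** Splitting a scalar into real and imaginary parts reduces complex linearity to real linearity and
    commutation with i. *)
Lemma complexify (S : 'L(Er, Fr)) : (forall x, S ('i%C *: (x : E)) = 'i%C *: (S x : F)) ->
  exists T : 'L(E, F), forall x, T x = S x.
Proof.
move=> Si.
have SD (x y : E) : S (x + y) = (S x : F) + S y :> F by exact: (linearD S).
have SZ (a : R) (x : E) : S (a%:C *: x) = a%:C *: (S x : F) :> F by exact: (linearZZ S).
have linS : linear (S : E -> F).
  by move=> a x y; rewrite SD (scale_complexE a x) SD !SZ Si -(scale_complexE a (S x : F)).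
have bS : (S : E -> F) \in bounded_linear.
  apply/bounded_linearP; split => //; exists (`|S|)%:C => x.
  by rewrite -!realification_normE -rmorphM lecR; exact: (le_bop_norm S x).
by exists (Bop bS).
Qed.

(** Upper bounds of the set defining [opnorm T] are nonnegative, hence real, so the real norm is its
    unique least upper bound. *)
Lemma opnorm_realify (T : 'L(E, F)) (S : 'L(Er, Fr)) :
  (forall x, S x = T x) -> opnorm T = `|S|%:C.
Proof.
move=> ST; rewrite /opnorm /supremum; case: ifPn => [/eqP T0|_].
  have : [set `|T x| | x in [set x : E | `|x| <= 1]] `|T 0|.
    by exists 0 => //=; rewrite normr0.
  by rewrite T0.
have SP : supremums [set `|T x| | x in [set x : E | `|x| <= 1]] `|S|%:C.
  split=> [_ [x /= x1 <-]|b bT].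
    rewrite -ST -realification_normE lecR; apply: le_trans (le_bop_norm S x) _.
    by rewrite ler_piMr// -lecR realification_normE.
  have b0 : 0 <= b by apply: le_trans (bT `|T 0| _) => //; exists 0; rewrite //= normr0.
  have bE : (complex.Re b)%:C = b by rewrite RRe_real// ger0_real.
  rewrite -bE lecR; apply: bop_norm_le_ball => x x1.
  rewrite -lecR bE realification_normE ST; apply: bT; exists x => //=.
  by rewrite -realification_normE lecR.
apply: xget_unique => // y [yu yl]; apply/eqP; rewrite eq_le.
by have [Su Sl] := SP; rewrite (yl _ Su) (Sl _ yu).
Qed.

(** The formula f(x) - i f(ix) recovers a complex functional from its real part. *)
Lemma complex_functional (f : 'L(Er, R^o)) :
  exists g : dual E, forall x, g x = (f x) +i* (- f ('i%C *: (x : E))).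
Proof.
pose h (x : E) : R[i]^o := (f x) +i* (- f ('i%C *: (x : E))).
have fD (x y : E) : f (x + y : E) = f x + f y by exact: (linearD f).
have fZ (a : R) (x : E) : f (a%:C *: x : E) = a * f x by exact: (linearZZ f).
have linh : linear h.
  move=> a x y.
  have ii : 'i%C *: ('i%C *: x) = (- 1)%:C *: x.
    by rewrite scalerA -expr2 sqr_i rmorphN1.
  rewrite /h scalerDr (scale_complexE a x) scalerDr !fD !(scalerA 'i%C) !(mulrC 'i%C).
  rewrite -!(scalerA _ 'i%C) ii !fZ.
  case: a => a b; apply/eqP; rewrite eq_complex /=; apply/andP; split; apply/eqP; ring.
have bh : h \in bounded_linear.
  apply/bounded_linearP; split => //; exists (`|f| + `|f|)%:C => x.
  have -> : h x = (f x)%:C + 'i%C * (- f ('i%C *: (x : E)))%:C by rewrite [LHS]complexE.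
  apply: le_trans (ler_normD _ _) _.
  rewrite normrM normCi mul1r !norm_real_complex -rmorphD/= -realification_normE -rmorphM/= lecR.
  rewrite mulrDl lerD ?normrN//; first exact: (le_bop_norm f x).
  apply: le_trans (le_bop_norm f _) _; rewrite ler_wpM2l// -lecR !realification_normE.
  by rewrite normrZ normCi mul1r.
by exists (Bop bh).
Qed.

End realified_operators.

Section complex_scalars.
Context {R : realType}.

Lemma mul_i_operator (E : normedModType R[i]) :
  exists J : 'L(realification E, realification E), forall x, J x = 'i%C *: (x : E).
Proof.
apply: (@bop_intro R (realification E) (realification E) (fun x : E => 'i%C *: x) 1).
  move=> a x y; rewrite -![a *: _]/(a%:C *: (_ : E)) scalerDr !scalerA.
  by rewrite [a%:C * _]mulrC.
by move=> x; rewrite -lecR rmorphM/= mul1r !realification_normE normrZ normCi mul1r.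
Qed.

(** The intertwiners of multiplication by i are the realified complex operators, with the same norms
    and norming vectors. So the real result about intertwiners applies to the realified set [K]. *)
Theorem James_property_complex (E F : completeNormedModType R[i]) :
  James_property E F -> exists T : 'L(E, F), ~ attains_norm T.
Proof.
move=> [A [cA A0 Afar]]; apply: contrapT => /forallNP natt.
have att (T : 'L(E, F)) : attains_norm T by apply: contrapT => nT; exact: (natt T nT).
pose Er : completeNormedModType R := realification E.
pose Fr : completeNormedModType R := realification F.
pose K : set 'L(Er, Fr) := [set S | exists2 T, A T & forall x, S x = T x].
have K_hull S : convex_hull K S -> exists2 T, convex_hull A T & forall x, S x = T x.
  apply: (@convex_hull_ind _ _ _ (fun S : 'L(Er, Fr) =>
    exists2 T, convex_hull A T & forall x, S x = T x)) => [S' [T AT ST]|S1 S2 t t01 [T1 A1 ST1] [T2 A2 ST2]].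
    by exists T => //; exact: sub_convex_hull.
  exists (t%:C *: T1 + (1 - t%:C) *: T2).
    by apply: convex_hull_conv => //; move: t01; rewrite !lecE /= eqxx.
  move=> x; rewrite bopD !bopZ ST1 ST2.
  by have -> : 1 - t%:C = (1 - t)%:C by rewrite rmorphB rmorph1.
have [d d0 Kd] : exists2 d, 0 < d & forall S, convex_hull K S -> d <= `|S|.
  move: Afar => /existsNP[e /not_implyP[e0 Ae]].
  have eE : (complex.Re e)%:C = e by rewrite RRe_real// gtr0_real.
  exists (complex.Re e) => [|S /K_hull[T AT ST]]; first by rewrite -ltcR eE.
  rewrite leNgt; apply/negP => Se; apply: Ae; exists T; split => //.
  rewrite /ball_/=; have -> : opnorm (0 - T) = `|- S|%:C.
    by apply: opnorm_realify => x; rewrite bopN ST sub0r.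
  by rewrite normrN -eE ltcR.
have [T0 [AT0 _]] := wot_closure_small [::] A0 (ltr01 : 0 < 1 :> R[i]).
have [S0 S0T] := realify T0.
have KS0 : K S0 by exists T0.
have [x0 Sx0] := nonzero_value (lt_le_trans d0 (Kd _ (sub_convex_hull KS0))).
have [JE JEE] := mul_i_operator E; have [JF JFE] := mul_i_operator F.
have [||||f|S [SJ]] := @non_norm_attaining_intertwiner R Er Fr JE JF K.
- by move=> S [T _ ST] x; rewrite JEE JFE !ST linearZ.
- move=> s e e0.
  (* A real functional is the real part of a complex one, so weak smallness over the complex field
     implies it over the reals. *)
  have /choice[g gE] (z : 'L(Fr, R^o)) := complex_functional z.
  have [T [AT Ts]] := wot_closure_small [seq (p.1 : E, g p.2) | p <- s] A0
    (ltac:(by rewrite ltcR) : 0 < e%:C).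
  have [S ST] := realify T; exists S; split; first by exists T.
  move=> p ps; have := Ts _ (map_f _ ps); rewrite /= gE ST => ps_lt.
  rewrite -ltcR; apply: le_lt_trans ps_lt; rewrite -Re_normK lecR.
  by apply: le_trans (Re_norm _).
- move=> S U UU KS.
  have /choice[T TP] n : exists T, A T /\ forall x, S n x = T x.
    by have [T AT ST] := KS n; exists T.
  have [T' T'P] := wot_ultra_cluster cA UU (fun n => proj1 (TP n)).
  have [S' S'T] := realify T'; exists S' => x z.
  have [g gE] := complex_functional z.
  apply/cvgrPdist_lt => e e0.
  have e0' : 0 < e%:C by rewrite ltcR.
  have /cvgrPdist_lt/(_ _ e0') := T'P x g.
  apply: filterS => n; rewrite !gE (proj2 (TP n)) S'T => ne.
  rewrite -ltcR; apply: le_lt_trans ne; rewrite -Re_normK lecR.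
  by apply: le_trans (Re_norm _).
- by exists d.
- have [g gE] := complex_functional f; pose y0 : F := S0 x0.
  have [_ [N gN]] := bounded_linearP _ (valP g).
  have bT : (fun x : E => g x *: y0) \in bounded_linear.
    apply/bounded_linearP; split; first by move=> a x y; rewrite linearP/= scalerDl scalerA.
    exists (N * `|y0|) => x; rewrite normrZ mulrAC ler_wpM2r//; exact: gN.
  have [S ST] := realify (Bop bT).
  have [x [x1]] := att (Bop bT); rewrite (opnorm_realify ST) /= normrZ => gx.
  have gmax y : `|y : Er| <= 1 -> `|g y| <= `|g x|.
    move=> y1; rewrite -(@ler_pM2r _ `|y0|) ?normr_gt0//.
    rewrite gx -normrZ -[_ *: _]/(Bop bT y) -ST -realification_normE lecR.
    by apply: le_trans (le_bop_norm S y) _; rewrite ler_piMr.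
  (* Rotating [x] by a unimodular scalar makes the value of [g] real and nonnegative, so its real
     part [f] attains there the maximal modulus of [g]. *)
  have [u u1 gu] : exists2 u : R[i], `|u| = 1 & g (u *: x) = `|g x|.
    have [gx0|gx0] := eqVneq (g x) 0.
      by exists 1; rewrite ?normr1// scale1r gx0 normr0.
    exists (`|g x| / g x); first by rewrite normrM normfV normr_id mulfV// normr_eq0.
    have -> : g (`|g x| / g x *: x) = `|g x| / g x * g x by exact: linearZZ.
    by rewrite divfK.
  have fRe y : f y = complex.Re (g y) by rewrite gE.
  apply: (@attains_normP _ _ _ f (u *: x : E)) => [|y /gmax gy].
    by rewrite -lecR realification_normE normrZ u1 mul1r.
  rewrite !fRe gu; apply: le_trans (Re_norm _) _; apply: le_trans (Re_le gy) _.
  exact: ler_norm.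
- apply.
  have [|T TS] := @complexify R E F S.
    by move=> x; have := SJ x; rewrite JEE JFE.
  have [x [x1 Tx]] := att T; exists x; split.
    by rewrite -lecR realification_normE.
  apply: (@complexI R); rewrite realification_normE -TS Tx.
  exact: opnorm_realify.
Qed.

End complex_scalars.

Theorem theoremA (R : realType) :
  (forall E F : completeNormedModType R,
     James_property E F -> exists T : 'L(E, F), ~ attains_norm T) /\
  (forall E F : completeNormedModType R[i],
     James_property E F -> exists T : 'L(E, F), ~ attains_norm T).
Proof. by split; [exact: James_property_real|exact: James_property_complex]. Qed.
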